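(* Let $\Gamma$ be a finite simplicial graph with vertex set $V=\{v_1,\dots,v_n\}$, let $A_\Gamma$ be the associated right-angled Artin group, and let $C_\Gamma(\iota)$ be the centraliser in $\mathrm{Aut}(A_\Gamma)$ of the automorphism $\iota$ that inverts each $v\in V$. The group $C_\Gamma(\iota)$ is generated by the diagram automorphisms, the adjacent dominated transvections, the inversions and the dominated elementary palindromic automorphisms of $A_\Gamma$.
   Context: $A_\Gamma$ is the group with generating set $V$ and relations $[v_i,v_j]=1$ whenever $v_i,v_j$ are joined by an edge of $\Gamma$. For a vertex $u$, $\mathrm{lk}(u)$ is the set of vertices adjacent to $u$ and $\mathrm{st}(u)=\mathrm{lk}(u)\cup\{u\}$; $u\le v$ means $\mathrm{lk}(u)\subset\mathrm{st}(v)$. Diagram automorphisms are those induced by graph automorphisms of $\Gamma$. The inversion $\iota_j$ maps $v_j\mapsto v_j^{-1}$ and fixes the other vertices. For $i\neq j$ with $v_i\le v_j$: the dominated transvection $\tau_{ij}$ maps $v_i\mapsto v_iv_j$ and fixes the other vertices, and is called adjacent if $[v_i,v_j]=1$; the dominated elementary palindromic automorphism $P_{ij}$ maps $v_i\mapsto v_jv_iv_j$ and fixes the other vertices. *)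

(* Defs.v *)
From HB Require Import structures.
From mathcomp Require Import all_boot perm.
From mathcomp Require Import boolp classical_sets.

Set Implicit Arguments.
Unset Strict Implicit.
Unset Printing Implicit Defensive.

Local Open Scope quotient_scope.
Local Open Scope group_scope.

Section Automorphisms.
Variable G : groupType.

Definition is_aut (f : G -> G) : Prop :=
  {morph f : x y / x * y} /\ bijective f.

(* is_aut is reflected in bool so that equality of automorphisms is equality *)
(* of the underlying functions.                                              *)
Record aut := Aut { aut_fun :> G -> G; _ : `[< is_aut aut_fun >] }.

HB.instance Definition _ := [isSub for aut_fun].
HB.instance Definition _ := [Choice of aut by <:].

Lemma autP (f : aut) : is_aut f.
Proof. by case: f => f /= /asboolP. Qed.

Lemma autM (f : aut) : {morph f : x y / x * y}.
Proof. by have [] := autP f. Qed.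

Lemma aut_bij (f : aut) : bijective f.
Proof. by have [] := autP f. Qed.

Lemma aut_ext (f g : aut) : f =1 g -> f = g.
Proof. by move=> fg; apply/val_inj/funext. Qed.

Definition mk_aut (f : G -> G) (fP : is_aut f) : aut := Aut (asboolT fP).

Fact aut_one_subproof : is_aut idfun.
Proof. by split=> //; exists idfun. Qed.

Fact aut_mul_subproof (f g : aut) : is_aut (f \o g).
Proof.
by split; [move=> x y /=; rewrite !autM | apply: bij_comp; apply: aut_bij].
Qed.

Fact aut_inv_ex (f : aut) : exists g : G -> G, cancel f g /\ cancel g f.
Proof. by have [g fK gK] := aut_bij f; exists g. Qed.

Fact aut_inv_subproof (f : aut) : is_aut (sval (cid (aut_inv_ex f))).
Proof.
case: cid => g /= [fK gK]; split; last by exists f.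
by move=> x y; rewrite -{1}(gK x) -{1}(gK y) -autM fK.
Qed.

(* The product of automorphisms is f * g = f \o g. *)
Definition aut_one := mk_aut aut_one_subproof.
Definition aut_mul f g := mk_aut (aut_mul_subproof f g).
Definition aut_inv f := mk_aut (aut_inv_subproof f).

Fact aut_mulA : associative aut_mul.
Proof. by move=> f g h; apply: aut_ext. Qed.
Fact aut_mul1 : left_id aut_one aut_mul.
Proof. by move=> f; apply: aut_ext. Qed.
Fact aut_mulr1 : right_id aut_one aut_mul.
Proof. by move=> f; apply: aut_ext. Qed.
Fact aut_mulV : left_inverse aut_one aut_inv aut_mul.
Proof. by move=> f; apply: aut_ext => x /=; case: cid => g /= []. Qed.
Fact aut_mulrV : right_inverse aut_one aut_inv aut_mul.
Proof. by move=> f; apply: aut_ext => x /=; case: cid => g /= []. Qed.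

HB.instance Definition _ :=
  isGroup.Build aut aut_mulA aut_mul1 aut_mulr1 aut_mulV aut_mulrV.

Lemma autME (f g : aut) x : (f * g) x = f (g x).
Proof. by []. Qed.

Lemma aut1E x : (1 : aut) x = x.
Proof. by []. Qed.

End Automorphisms.

Definition centraliser (G : groupType) (x : G) : set G :=
  [set y | commute x y].

Definition subgroup_gen (G : groupType) (S : set G) : set G :=
  smallest (fun H : set G => group_closed (mem H)) S.

Section RAAG.
Variables (V : finType) (e : rel V).

(* A word in the letters v (= (v, false)) and v^-1 (= (v, true)). *)
Definition word := seq (V * bool).

Definition letter_inv (a : V * bool) : V * bool := (a.1, ~~ a.2).
Definition word_inv (w : word) : word := rev (map letter_inv w).

(* The least congruence on words, for concatenation, that contains the free *)
(* cancellations and the relations u v = v u for u, v joined by an edge.    *)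
Inductive word_eqv : word -> word -> Prop :=
| WordRefl w : word_eqv w w
| WordSym w1 w2 : word_eqv w1 w2 -> word_eqv w2 w1
| WordTrans w1 w2 w3 : word_eqv w1 w2 -> word_eqv w2 w3 -> word_eqv w1 w3
| WordCat w1 w2 w3 w4 :
    word_eqv w1 w2 -> word_eqv w3 w4 -> word_eqv (w1 ++ w3) (w2 ++ w4)
| WordCancel a : word_eqv [:: a; letter_inv a] [::]
| WordComm u v : e u v ->
    word_eqv [:: (u, false); (v, false)] [:: (v, false); (u, false)].

Definition word_eqvb : rel word := fun w1 w2 => `[< word_eqv w1 w2 >].

Fact word_eqvb_refl : reflexive word_eqvb.
Proof. by move=> w; apply/asboolP/WordRefl. Qed.

Fact word_eqvb_sym : symmetric word_eqvb.
Proof. by move=> w1 w2; apply/asboolP/asboolP; apply: WordSym. Qed.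

Fact word_eqvb_trans : transitive word_eqvb.
Proof.
by move=> w2 w1 w3 /asboolP w12 /asboolP w23; apply/asboolP/(WordTrans w12).
Qed.

Canonical word_eqvb_equiv :=
  EquivRel word_eqvb word_eqvb_refl word_eqvb_sym word_eqvb_trans.

Definition raag := {eq_quot word_eqvb}.

HB.instance Definition _ := Choice.on raag.

Definition raag_class (w : word) : raag := \pi_raag w.

Lemma raag_classP w1 w2 :
  raag_class w1 = raag_class w2 <-> word_eqv w1 w2.
Proof. by split=> [/eqmodP/asboolP | w12] //; apply/eqmodP/asboolP. Qed.

Lemma raag_reprK (x : raag) : raag_class (repr x) = x.
Proof. exact: reprK. Qed.

Lemma repr_raag_class w : word_eqv (repr (raag_class w)) w.
Proof. by apply/raag_classP; rewrite raag_reprK. Qed.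

Lemma letter_invK : involutive letter_inv.
Proof. by case=> v b; rewrite /letter_inv /= negbK. Qed.

Lemma word_invK : involutive word_inv.
Proof.
by move=> w; rewrite /word_inv map_rev revK -map_comp map_id_in // => a _;
   apply: letter_invK.
Qed.

Lemma word_inv_cat w1 w2 : word_inv (w1 ++ w2) = word_inv w2 ++ word_inv w1.
Proof. by rewrite /word_inv map_cat rev_cat. Qed.

Lemma word_mulV w : word_eqv (w ++ word_inv w) [::].
Proof.
elim: w => [|a w IHw]; first exact: WordRefl.
rewrite -cat1s word_inv_cat -catA (catA w).
apply: (WordTrans _ (WordCancel a)).
apply: (WordCat (WordRefl [:: a])).
by rewrite -[X in word_eqv _ X]cat0s; apply: WordCat IHw (WordRefl _).
Qed.

Lemma word_mulVl w : word_eqv (word_inv w ++ w) [::].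
Proof. by rewrite -{2}(word_invK w); apply: word_mulV. Qed.

Lemma word_eqv_inv w1 w2 :
  word_eqv w1 w2 -> word_eqv (word_inv w1) (word_inv w2).
Proof.
move=> w12; rewrite -[word_inv w1]cats0.
apply: (@WordTrans _ (word_inv w1 ++ (w2 ++ word_inv w2))).
  by apply: WordCat (WordRefl _) (WordSym (word_mulV w2)).
rewrite catA -[X in word_eqv _ X]cat0s; apply: WordCat (WordRefl _).
apply: WordTrans (word_mulVl w1).
by apply: WordCat (WordRefl _) (WordSym w12).
Qed.

Definition raag_one : raag := raag_class [::].
Definition raag_mul (x y : raag) : raag := raag_class (repr x ++ repr y).
Definition raag_inv (x : raag) : raag := raag_class (word_inv (repr x)).

Fact raag_mul_class w1 w2 :
  raag_mul (raag_class w1) (raag_class w2) = raag_class (w1 ++ w2).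
Proof. by apply/raag_classP/WordCat; apply: repr_raag_class. Qed.

Fact raag_inv_class w : raag_inv (raag_class w) = raag_class (word_inv w).
Proof. by apply/raag_classP/word_eqv_inv/repr_raag_class. Qed.

Fact raag_mulA : associative raag_mul.
Proof.
move=> x y z; rewrite -(raag_reprK x) -(raag_reprK y) -(raag_reprK z).
by rewrite !raag_mul_class catA.
Qed.
Fact raag_mul1 : left_id raag_one raag_mul.
Proof. by move=> x; rewrite -(raag_reprK x) raag_mul_class. Qed.
Fact raag_mulr1 : right_id raag_one raag_mul.
Proof. by move=> x; rewrite -(raag_reprK x) raag_mul_class cats0. Qed.
Fact raag_mulV : left_inverse raag_one raag_inv raag_mul.
Proof.
move=> x; rewrite -(raag_reprK x) raag_inv_class raag_mul_class.
exact/raag_classP/word_mulVl.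
Qed.
Fact raag_mulrV : right_inverse raag_one raag_inv raag_mul.
Proof.
move=> x; rewrite -(raag_reprK x) raag_inv_class raag_mul_class.
exact/raag_classP/word_mulV.
Qed.

HB.instance Definition _ :=
  isGroup.Build raag raag_mulA raag_mul1 raag_mulr1 raag_mulV raag_mulrV.

Lemma raag_classM w1 w2 : raag_class (w1 ++ w2) = raag_class w1 * raag_class w2.
Proof. by rewrite -raag_mul_class. Qed.

Definition gen (v : V) : raag := raag_class [:: (v, false)].

Lemma raag_class_letter a :
  raag_class [:: a] = if a.2 then (gen a.1)^-1 else gen a.1.
Proof.
by case: a => v [] //=; apply/esym; apply: (raag_inv_class [:: (v, false)]).
Qed.

Lemma gen_commute u v : e u v -> commute (gen u) (gen v).
Proof.
by move=> euv; rewrite /commute -!raag_classM; apply/raag_classP/WordComm.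
Qed.

Section Lift.
Variables (H : groupType) (f : V -> H).

Definition letter_eval (a : V * bool) : H := if a.2 then (f a.1)^-1 else f a.1.
Definition word_eval (w : word) : H := \prod_(a <- w) letter_eval a.
Definition raag_lift (x : raag) : H := word_eval (repr x).

Hypothesis fP : forall u v, e u v -> commute (f u) (f v).

Lemma word_eval_eqv w1 w2 : word_eqv w1 w2 -> word_eval w1 = word_eval w2.
Proof.
rewrite /word_eval; elim=> {w1 w2} [//|//|w1 w2 w3 _ -> _ -> //||a|u v euv].
- by move=> w1 w2 w3 w4 _ IH1 _ IH2; rewrite !big_cat /= IH1 IH2.
- rewrite big_cons big_seq1 big_nil /letter_eval.
  by case: a => v [] /=; rewrite ?mulVg ?mulgV.
- by rewrite !big_cons big_nil !mulg1; apply: fP.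
Qed.

Lemma raag_lift_class w : raag_lift (raag_class w) = word_eval w.
Proof. exact/word_eval_eqv/repr_raag_class. Qed.

Lemma raag_liftM : {morph raag_lift : x y / x * y}.
Proof.
move=> x y; rewrite -(raag_reprK x) -(raag_reprK y) -raag_classM.
by rewrite !raag_lift_class /word_eval big_cat.
Qed.

Lemma raag_lift_gen v : raag_lift (gen v) = f v.
Proof. by rewrite raag_lift_class /word_eval big_seq1. Qed.

End Lift.

Lemma raag_morph_ext (H : groupType) (f g : raag -> H) :
    {morph f : x y / x * y} -> {morph g : x y / x * y} ->
  (forall v, f (gen v) = g (gen v)) -> f =1 g.
Proof.
move=> fM gM fg x.
have f1 : f 1 = 1 by apply: (@mulgI _ (f 1)); rewrite -fM !mulg1.
have g1 : g 1 = 1 by apply: (@mulgI _ (g 1)); rewrite -gM !mulg1.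
have fV y : f y^-1 = (f y)^-1.
  by apply: (@mulgI _ (f y)); rewrite -fM !mulgV.
have gV y : g y^-1 = (g y)^-1.
  by apply: (@mulgI _ (g y)); rewrite -gM !mulgV.
rewrite -(raag_reprK x); elim: (repr x) => [|a w IHw].
  by rewrite -[raag_class [::]]/(1 : raag) f1 g1.
rewrite -cat1s raag_classM fM gM IHw raag_class_letter.
by case: a.2; rewrite ?fV ?gV fg.
Qed.

Definition iota_fun : raag -> raag := raag_lift (fun v => (gen v)^-1).

Fact iota_commute u v : e u v -> commute (gen u)^-1 (gen v)^-1.
Proof.
by move=> /gen_commute uv; rewrite /commute -!invgM uv.
Qed.

Fact iota_subproof : is_aut iota_fun.
Proof.
have iM : {morph iota_fun : x y / x * y} := raag_liftM iota_commute.
split=> //.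
have iV v : iota_fun (gen v)^-1 = gen v.
  rewrite -[(gen v)^-1](raag_class_letter (v, true)) /iota_fun.
  by rewrite (raag_lift_class iota_commute) /word_eval big_seq1 /letter_eval invgK.
suff iK : cancel iota_fun iota_fun by exists iota_fun.
apply: (@raag_morph_ext _ (iota_fun \o iota_fun) id) => [x y|//|v] /=.
  by rewrite !iM.
by rewrite {2}/iota_fun (raag_lift_gen iota_commute) iV.
Qed.

Definition raag_iota : aut raag := mk_aut iota_subproof.

Lemma raag_iota_gen v : raag_iota (gen v) = (gen v)^-1.
Proof. exact: raag_lift_gen iota_commute v. Qed.

Definition lk (u : V) : {set V} := [set v | e u v].
Definition st (u : V) : {set V} := u |: lk u.
Definition dominated (u v : V) : bool := lk u \subset st v.

(* By raag_morph_ext each of the following conditions on the images of the  *)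
(* generators determines the automorphism f.                                *)

Definition diagram_auts : set (aut raag) :=
  [set f | exists s : {perm V},
     {mono s : u v / e u v} /\ forall u, f (gen u) = gen (s u)].

Definition is_inversion (j : V) (f : aut raag) : Prop :=
  f (gen j) = (gen j)^-1 /\ forall k, k != j -> f (gen k) = gen k.

Definition is_transvection (i j : V) (f : aut raag) : Prop :=
  f (gen i) = gen i * gen j /\ forall k, k != i -> f (gen k) = gen k.

Definition is_elem_palindromic (i j : V) (f : aut raag) : Prop :=
  f (gen i) = gen j * gen i * gen j /\
  forall k, k != i -> f (gen k) = gen k.

Definition inversions : set (aut raag) :=
  [set f | exists j, is_inversion j f].

Definition adjacent_dominated_transvections : set (aut raag) :=
  [set f | exists i j, [/\ i != j, dominated i j,
     [~ gen i, gen j] = 1 & is_transvection i j f]].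

Definition dominated_elem_palindromics : set (aut raag) :=
  [set f | exists i j, [/\ i != j, dominated i j & is_elem_palindromic i j f]].

End RAAG.

Arguments raag_iota {V} e.
Arguments diagram_auts {V} e.
Arguments inversions {V} e.
Arguments adjacent_dominated_transvections {V} e.
Arguments dominated_elem_palindromics {V} e.

(* Main.v *)
Require Import Defs.
From mathcomp Require Import boolp classical_sets.
From mathcomp Require Import all_boot ssralg ssrnum ssrint intdiv.
From mathcomp Require Import perm matrix zmodp zify.

(** An automorphism [f] commutes with [iota] if and only if it commutes with
    reversal, the anti-automorphism that reads words backwards. So [f] maps the
    vertices to palindromes, and the proof studies palindromes instead of general
    elements.

    Modulo 2 the situation is rigid. Counting ordered pairs of letters shows that
    the vertices with odd exponent in a palindrome form a clique, and that
    commuting elements satisfy a determinantal relation for every non-adjacent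
    pair of vertices. Hence [f] maps the span of the star of [v] into the span of
    the star of every vertex that is odd in [f v]. A non-zero term of the
    determinant of [f] modulo 2 then turns out to be a graph automorphism, and
    once it is moved to the diagonal the other entries are removed by adjacent
    transvections ([pure_reduction]). This leaves the pure case, where [f] is the identity
    modulo 2.

    For a pure [f] every vertex in [f v] dominates [v] ([pure_support]). This
    rests on Bass-Serre theory: for a set [K] of pairwise non-adjacent vertices
    with a common link, the number [tlen] of letters of [K] in a shortest word is
    the distance by which the element moves the base vertex of a tree. A palindrome starts and ends with the same
    letter, so it is cyclically reduced and translates an axis through the base
    vertex; its centraliser acts on this axis, and outside the link of [u] the
    exponents of commuting elements are governed by one character. But modulo 2
    the images of [v] and of its neighbours have independent exponents, which
    leaves no room for a [u] that does not dominate [v].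

    Now the classes of vertices that dominate each other are cleared from the top
    of the dominance order ([pure_gen]). If a class contains an edge, it forms
    a clique with everything above it, the images lie in a free abelian group, and
    a Euclidean algorithm with even steps succeeds ([clique_class]). Otherwise the class [K] is
    independent with a common link, and [f k] is a palindrome [h k h^rev], up to
    the sign of the middle letter, for every [k] in [K]. If no half [h] contains
    more than half of the image of another vertex of [K], then all the middle
    letters survive in every product of such images; since [f] is onto, the halves
    avoid [K] and can be removed. If some half does, an elementary palindromic
    automorphism shortens it ([free_class]), as in Nielsen's method. *)

Set Implicit Arguments.
Unset Strict Implicit.
Unset Printing Implicit Defensive.

Local Open Scope group_scope.

(** * Words, retractions and reversal *)

Definition gnorm := (@mulgA, @mulgK, @mulgVK, @mulVg, @mulgV, @mul1g, @mulg1,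
  @invgM, @invgK, @invg1).

Section Words.
Variables (V : finType) (e : rel V).
Local Notation A := (raag e).
Implicit Types (u v w : V) (a b : V * bool) (g h x y : A) (S T : {set V}).

Definition letter a : A := raag_class e [:: a].

Lemma letter_gen v : letter (v, false) = gen e v.
Proof. by []. Qed.

Lemma letterV a : letter (letter_inv a) = (letter a)^-1.
Proof. by case: a => v []; rewrite /letter !raag_class_letter /= ?invgK. Qed.

Lemma letter_genV v : letter (v, true) = (gen e v)^-1.
Proof. exact: (letterV (v, false)). Qed.

Lemma raag_ind (P : A -> Prop) :
  P 1 -> (forall a g, P g -> P (letter a * g)) -> forall g, P g.
Proof.
move=> P1 Pl g; rewrite -(raag_reprK g); elim: (repr g) => // a w IHw.
by rewrite -cat1s raag_classM; apply: Pl.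
Qed.

Section Morphisms.
Variables (H : groupType) (f : A -> H).
Hypothesis fM : {morph f : x y / x * y}.

Lemma morph1 : f 1 = 1.
Proof. by apply: (@mulgI _ (f 1)); rewrite -fM !mulg1. Qed.

Lemma morphV : {morph f : x / x^-1}.
Proof. by move=> x; apply: (@mulgI _ (f x)); rewrite -fM !mulgV morph1. Qed.

End Morphisms.

Definition ret S : A -> A :=
  raag_lift (fun v => if v \in S then gen e v else 1).

Lemma ret_comm S u v : e u v ->
  commute (if u \in S then gen e u else 1) (if v \in S then gen e v else 1).
Proof.
by move=> uv; case: ifP => _; case: ifP => _; rewrite /commute ?gnorm //;
   apply: gen_commute.
Qed.

Lemma retM S : {morph ret S : x y / x * y}.
Proof. exact: raag_liftM (@ret_comm S). Qed.

Lemma ret1 S : ret S 1 = 1. Proof. exact: morph1 (@retM S). Qed.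
Lemma retV S : {morph ret S : x / x^-1}. Proof. exact: morphV (@retM S). Qed.

Lemma ret_gen S v : ret S (gen e v) = if v \in S then gen e v else 1.
Proof. exact: raag_lift_gen (@ret_comm S) v. Qed.

Lemma ret_letter S a : ret S (letter a) = if a.1 \in S then letter a else 1.
Proof.
case: a => v [] /=; rewrite ?letter_genV ?letter_gen ?retV ret_gen //.
by case: ifP => //; rewrite invg1.
Qed.

Lemma retI S T g : ret S (ret T g) = ret (S :&: T) g.
Proof.
elim/raag_ind: g => [|a g IHg]; rewrite ?ret1 // !retM IHg !ret_letter inE.
by case: (a.1 \in T); rewrite ?andbF ?ret1 ?ret_letter ?andbT.
Qed.

(** The subgroup generated by [S], as the fixed points of the retraction that
    kills the other vertices: membership is an equation, and an intersection
    of such subgroups is again one of them. *)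
Definition parab S : {pred A} := [pred g | ret S g == g].

Lemma parabP S g : reflect (ret S g = g) (g \in parab S).
Proof. exact: eqP. Qed.

Lemma parab1 S : 1 \in parab S. Proof. by apply/parabP/ret1. Qed.

Lemma parabM S g h : g \in parab S -> h \in parab S -> g * h \in parab S.
Proof. by move=> /parabP gS /parabP hS; apply/parabP; rewrite retM gS hS. Qed.

Lemma parabV S g : (g^-1 \in parab S) = (g \in parab S).
Proof. by rewrite !inE retV (inj_eq (@invg_inj _)). Qed.

Lemma parabMl S g h : g \in parab S -> (g * h \in parab S) = (h \in parab S).
Proof.
move=> gS; apply/idP/idP => [hgS|hS]; last exact: parabM.
by rewrite -(mulKg g h) parabM ?parabV.
Qed.

Lemma parab_letter S a : a.1 \in S -> letter a \in parab S.
Proof. by move=> aS; apply/parabP; rewrite ret_letter aS. Qed.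

Lemma parab_gen S v : v \in S -> gen e v \in parab S.
Proof. exact: (@parab_letter S (v, false)). Qed.

Lemma ret_parab S g : ret S g \in parab S.
Proof. by apply/parabP; rewrite retI setIid. Qed.

Lemma parab_ret S T g : g \in parab T -> ret S g \in parab T.
Proof. by move=> /parabP gT; apply/parabP; rewrite retI setIC -retI gT. Qed.

Lemma parabI S T g : (g \in parab (S :&: T)) = (g \in parab S) && (g \in parab T).
Proof.
apply/idP/andP => [/parabP<-|[/parabP gS /parabP gT]]; last first.
  by apply/parabP; rewrite -retI gT gS.
split; apply/parabP; rewrite retI; congr ret; apply/setP => x; rewrite !inE.
  by rewrite andbA andbb.
by rewrite andbCA andbb.
Qed.

Lemma parabS S T g : S \subset T -> g \in parab S -> g \in parab T.
Proof. by move=> /setIidPl <-; rewrite parabI => /andP[]. Qed.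

Lemma parabT g : g \in parab setT.
Proof.
apply/parabP; elim/raag_ind: g => [|a g IHg]; first exact: ret1.
by rewrite retM IHg ret_letter inE.
Qed.

Lemma parab_ind S (P : A -> Prop) :
  P 1 -> (forall a g, a.1 \in S -> g \in parab S -> P g -> P (letter a * g)) ->
  forall g, g \in parab S -> P g.
Proof.
move=> P1 Pl g /parabP <-; elim/raag_ind: g => [|a g IHg]; first by rewrite ret1.
rewrite retM ret_letter; case: ifP => aS; last by rewrite mul1g.
exact: Pl aS (ret_parab S g) IHg.
Qed.

(** The retractions killing the single vertices outside [S] compose to the
    retraction onto [S]. *)
Lemma parab_support S g :
  (forall u, u \notin S -> g \in parab [set~ u]) -> g \in parab S.
Proof.
move=> gS; suff : g \in parab (\bigcap_(u in ~: S) [set~ u]).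
  apply: parabS; apply/subsetP => u /bigcapP uS; apply: contraT => u'S.
  by have /uS : u \in ~: S; rewrite !inE // eqxx.
apply: (big_ind (fun T => g \in parab T)) => [||u]; first exact: parabT.
  by move=> S1 S2 gS1 gS2; rewrite parabI gS1.
by rewrite inE; apply: gS.
Qed.

Lemma letter_commute a b : e a.1 b.1 -> commute (letter a) (letter b).
Proof.
case: a b => [u i] [v j] /= uv; have C := gen_commute uv.
have {}C : commute (gen e u) (letter (v, j)) by case: j; rewrite ?letter_genV //; apply: commuteV.
by case: i; rewrite ?letter_genV //; apply/commute_sym/commuteV/commute_sym.
Qed.

Lemma commute_parab x S g :
  (forall v, v \in S -> commute x (gen e v)) -> g \in parab S -> commute x g.
Proof.
move=> xS; elim/parab_ind => [|[v i] h /= vS _ IH]; first exact: commute1.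
apply: commuteM IH; case: i; rewrite ?letter_genV ?letter_gen; last exact: xS.
exact/commuteV/xS.
Qed.

(** ** Reversal *)

(** Words are read backwards: inverting and then applying [iota] leaves the signs
    of the letters as they were. *)
Fact reversal_key : unit. Proof. exact tt. Qed.
Definition reversal g : A := locked_with reversal_key (raag_iota e g)^-1.

Lemma reversalE g : reversal g = (raag_iota e g)^-1.
Proof. exact: locked_withE. Qed.

Lemma reversalM g h : reversal (g * h) = reversal h * reversal g.
Proof. by rewrite !reversalE autM invgM. Qed.

Lemma reversal1 : reversal 1 = 1.
Proof. by rewrite reversalE (morph1 (@autM _ (raag_iota e))) invg1. Qed.

Lemma reversalV g : reversal g^-1 = (reversal g)^-1.
Proof. by apply: (@mulgI _ (reversal g)); rewrite -reversalM mulVg reversal1 mulgV. Qed.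

Lemma reversal_gen v : reversal (gen e v) = gen e v.
Proof. by rewrite reversalE raag_iota_gen invgK. Qed.

Lemma reversal_letter a : reversal (letter a) = letter a.
Proof. by case: a => v []; rewrite ?letter_genV ?reversalV reversal_gen. Qed.

Lemma reversalK : involutive reversal.
Proof.
by elim/raag_ind => [|a g IHg]; rewrite ?reversal1 // !reversalM IHg !reversal_letter.
Qed.

Lemma reversal_ret S g : reversal (ret S g) = ret S (reversal g).
Proof.
elim/raag_ind: g => [|a g IHg]; first by rewrite ret1 reversal1 ret1.
rewrite retM !reversalM retM IHg !reversal_letter ret_letter.
by case: ifP; rewrite ?reversal_letter ?reversal1.
Qed.

Lemma parab_rev S g : (reversal g \in parab S) = (g \in parab S).
Proof. by rewrite !inE -reversal_ret (inj_eq (can_inj reversalK)). Qed.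

Lemma centraliser_rev (f : aut A) :
  centraliser (raag_iota e) f -> forall g, f (reversal g) = reversal (f g).
Proof.
move=> fC g; rewrite !reversalE (morphV (@autM _ f)); congr (_^-1).
by rewrite -!autME fC.
Qed.

End Words.

(** * Exponents modulo 2 *)

Section Parity.
Variables (V : finType) (e : rel V).
Hypotheses (e_sym : symmetric e) (e_irr : irreflexive e).
Local Notation A := (raag e).
Local Notation parab := (@parab V e).
Local Notation letter := (@letter V e).
Local Notation reversal := (@reversal V e).
Implicit Types (u v : V) (a b : V * bool) (g h x y : A) (S T : {set V}).

(** A homomorphism modulo 2, so the choice of the word does not matter. *)
Definition par S g := odd (count (fun a => a.1 \in S) (repr g)).

Lemma par_class S (w : word V) :
  par S (raag_class e w) = odd (count (fun a => a.1 \in S) w).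
Proof.
suff E w1 w2 : word_eqv e w1 w2 ->
    odd (count (fun a => a.1 \in S) w1) = odd (count (fun a => a.1 \in S) w2).
  exact/E/repr_raag_class.
elim=> {w w1 w2} // [w1 w2 w3 _ -> _ ->|w1 w2 w3 w4 _ E1 _ E2|a|u v _] //=.
- by rewrite !count_cat !oddD E1 E2.
- by rewrite addn0 addnn odd_double.
- by rewrite !addn0 addnC.
Qed.

Lemma parM S g h : par S (g * h) = par S g (+) par S h.
Proof.
rewrite -{1}(raag_reprK g) -{1}(raag_reprK h).
by rewrite -(raag_classM e (repr g)) par_class count_cat oddD.
Qed.

Lemma par1 S : par S 1 = false.
Proof. exact: (par_class S [::]). Qed.

Lemma parV S g : par S g^-1 = par S g.
Proof.
by have := parM S g g^-1; rewrite mulgV par1; case: (par S g); case: (par S _).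
Qed.

Lemma par_letter S a : par S (letter a) = (a.1 \in S).
Proof. by rewrite par_class /= addn0; case: (_ \in _). Qed.

Lemma par_gen S v : par S (gen e v) = (v \in S).
Proof. exact: (par_letter S (v, false)). Qed.

Lemma par_rev S g : par S (reversal g) = par S g.
Proof.
elim/raag_ind: g => [|a g IHg]; first by rewrite reversal1.
by rewrite reversalM !parM IHg reversal_letter addbC.
Qed.

Lemma par_sum S g : par S g = \big[addb/false]_(u in S) par [set u] g.
Proof.
elim/raag_ind: g => [|a g IHg].
  by rewrite par1 big1 // => u _; rewrite par1.
rewrite parM IHg; under [RHS]eq_bigr do rewrite parM.
rewrite big_split /=; congr addb; rewrite par_letter.
have [aS|aS] := boolP (a.1 \in S).
  rewrite (bigD1 a.1) //= par_letter set11 big1 // => u /andP[_ ua].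
  by rewrite par_letter inE eq_sym (negPf ua).
rewrite big1 // => u uS; rewrite par_letter inE.
by apply: contraNF aS => /eqP->.
Qed.

Lemma par_parab S T g : [disjoint S & T] -> g \in parab T -> par S g = false.
Proof.
move=> ST; elim/parab_ind => [|a h aT _ IH]; first exact: par1.
by rewrite parM IH par_letter (disjointFl ST aT).
Qed.

(** ** Ordered pairs of letters *)

(** The parity of the number of occurrences of [u] before [v]. Together with the
    two exponents this is the image of a word in the dihedral group of order 8
    generated by the involutions [u] and [v]. *)
Fixpoint cross u v (w : word V) : bool :=
  if w is a :: w' then
    (a.1 == u) && odd (count (fun b => b.1 \in [set v]) w') (+) cross u v w'
  else false.

Lemma cross_cat u v (w1 w2 : word V) : cross u v (w1 ++ w2) =
  cross u v w1 (+) cross u v w2 (+)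
  odd (count (fun b => b.1 \in [set u]) w1) && odd (count (fun b => b.1 \in [set v]) w2).
Proof.
elim: w1 => [|a w IHw] /=; first by rewrite addbF.
rewrite IHw count_cat !oddD inE oddb andb_addr andb_addl.
by rewrite -!addbA; congr addb; rewrite addbC -!addbA; do 2!congr addb; rewrite addbC.
Qed.

Lemma cross_eqv u v (w1 w2 : word V) : u != v -> ~~ e u v ->
  word_eqv e w1 w2 -> cross u v w1 = cross u v w2.
Proof.
move=> uv euv.
elim=> {w1 w2} // [w1 w2 w3 _ -> _ -> //|w1 w2 w3 w4 E12 IH1 E34 IH2|a|s t st] /=.
- rewrite !cross_cat IH1 IH2 -!par_class.
  by move/raag_classP: E12 => ->; move/raag_classP: E34 => ->.
- rewrite !inE addn0; case: eqP => // ->.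
  by rewrite (negPf uv).
rewrite !inE !addn0 !andbF !addbF !oddb; apply/andP/andP => -[/eqP su /eqP tv].
  by move: euv; rewrite -su -tv st.
by move: euv; rewrite -su -tv e_sym st.
Qed.

(** Reading a palindrome backwards exchanges the pairs [uv] with the pairs [vu],
    and together there are as many as the product of the two exponents. *)
Lemma par_palindrome u v g : u != v -> ~~ e u v -> reversal g = g ->
  ~~ (par [set u] g && par [set v] g).
Proof.
move=> uv euv gP.
have E w : cross u v w (+) cross u v (rev w) =
    odd (count (fun b => b.1 \in [set u]) w) && odd (count (fun b => b.1 \in [set v]) w).
  elim: w => //= a w IHw; rewrite rev_cons -cats1 cross_cat /= !addn0 oddD inE.
  rewrite andbF /= addbF !count_rev !oddD !oddb !inE.
  move: IHw; have : ~~ ((a.1 == u) && (a.1 == v)).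
    by apply: contra uv => /andP[/eqP <- /eqP <-].
  move: (cross u v w) (cross u v (rev w)) => c c'.
  move: (odd (count _ w)) (odd (count _ w)) (a.1 == u) (a.1 == v).
  by case: c c' => [] [] [] [] [] [].
have reversal_class w : reversal (raag_class e w) = raag_class e (rev w).
  elim: w => [|a w IHw]; first exact: reversal1.
  by rewrite -cat1s raag_classM reversalM reversal_letter IHw -raag_classM rev_cat.
move: (E (repr g)); rewrite -!par_class raag_reprK => <-.
rewrite negb_add; apply/eqP/cross_eqv => //; apply/raag_classP.
by rewrite -reversal_class raag_reprK.
Qed.

Lemma par_commute u v g h : u != v -> ~~ e u v -> commute g h ->
  par [set u] g && par [set v] h = par [set u] h && par [set v] g.
Proof.
move=> uv euv gh.
have := @cross_eqv u v (repr g ++ repr h) (repr h ++ repr g) uv euv.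
rewrite !cross_cat -!par_class !raag_reprK => E.
have /E : word_eqv e (repr g ++ repr h) (repr h ++ repr g).
  by apply/raag_classP; rewrite !raag_classM !raag_reprK.
move: (cross u v (repr g)) (cross u v (repr h)).
by move: (par _ g) (par _ h) (par _ h) (par _ g) => [] [] [] [] [] [].
Qed.

End Parity.

(** * Reduced stacks *)

Section Stack.
Variables (E : eqType) (einv : E -> E).
Hypothesis einvK : involutive einv.
Implicit Types (f : E) (p q s t : seq E).

Fixpoint lcp s t : nat :=
  match s, t with
  | x :: s', y :: t' => if x == y then (lcp s' t').+1 else 0
  | _, _ => 0
  end.

Lemma lcpC s t : lcp s t = lcp t s.
Proof. by elim: s t => [|x s IHs] [|y t] //=; rewrite eq_sym IHs. Qed.

Lemma lcp_size s t : lcp s t <= size s.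
Proof. by elim: s t => [|x s IHs] [|y t] //=; case: eqP => // _; apply: IHs. Qed.

Lemma lcp_ultra s t r : minn (lcp s t) (lcp t r) <= lcp s r.
Proof.
elim: s t r => [|a s IHs] [|b t] [|c r] //=; rewrite ?minn0 ?min0n //.
case: (a =P b) => [<-|_]; last by rewrite min0n.
by case: (a =P c) => _; rewrite ?minn0 // minnSS; apply: IHs.
Qed.

Lemma lcp_cat r s t : lcp (r ++ s) (r ++ t) = size r + lcp s t.
Proof. by elim: r => //= x r ->; rewrite eqxx. Qed.

Definition push f p : seq E :=
  if p is f' :: p' then if f' == einv f then p' else f :: p else [:: f].

Definition red p := sorted (fun f f' => f' != einv f) p.

Lemma red_behead f p : red (f :: p) -> red p.
Proof. exact: path_sorted. Qed.

Lemma push_red f p : red p -> red (push f p).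
Proof.
case: p => // f' p rp /=; case: eqP => [_|/eqP ff'] /=; last by rewrite ff'.
exact: red_behead rp.
Qed.

Lemma pushK f p : red p -> push f (push (einv f) p) = p.
Proof.
case: p => [|f' p] rp /=; first by rewrite eqxx.
rewrite einvK; case: eqP => [<-|] /=; last by rewrite eqxx.
by case: p rp => //= f'' p /andP[/negPf->].
Qed.

Lemma pushKV f p : red p -> push (einv f) (push f p) = p.
Proof. by move=> rp; rewrite -{2}[f]einvK pushK. Qed.

Lemma foldr_push_red p q : red p -> red (foldr push p q).
Proof. by move=> rp; elim: q => //= f q; apply: push_red. Qed.

Lemma push_foldr f p q : red p -> red q ->
  push f (foldr push p q) = foldr push p (push f q).
Proof.
move=> rp; case: q => //= f' q rq; case: eqP => //= ->.
by rewrite pushK ?foldr_push_red.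
Qed.

Lemma foldl_push_cat p q : red q ->
  (forall f g, ohead p = Some g -> ohead q = Some f -> f != einv g) ->
  foldl (fun s f => push f s) p q = rev q ++ p.
Proof.
elim: q p => //= f q IHq p rq pq; rewrite rev_cons cat_rcons.
have -> : push f p = f :: p.
  case: p pq => //= g p /(_ f g erefl erefl); rewrite -(inv_eq einvK) eq_sym.
  by move=> /negPf; rewrite eq_sym => ->.
apply: IHq => [|h g [<-]]; first exact: red_behead rq.
by case: q rq => //= h' q /andP[hf _] [<-].
Qed.

(** Pushing the letters of [q] onto [p] cancels a part [p1] of [p] against as
    many letters of [q], and then nothing more: the two letters that could still
    be compared just above [p2] differ. *)
Lemma foldl_push_split p q : red p -> red q ->
  exists q1 q2 p1 p2, [/\ p = p1 ++ p2, q = q2 ++ q1, size q2 = size p1,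
    foldl (fun s f => push f s) p q = rev q1 ++ p2 &
    forall f g, ohead q1 = Some f -> ohead (rev p1) = Some g -> f != g].
Proof.
elim: q p => [|f q IHq] p rp rq; first by exists [::], [::], [::], p.
case: p rp => [|g p] rp.
  exists (f :: q), [::], [::], [::]; split=> //.
  by rewrite foldl_push_cat ?cats0.
have [fg|fg] := eqVneq f (einv g); last first.
  exists (f :: q), [::], [::], (g :: p); split=> //.
  by rewrite foldl_push_cat // => f' g' [<-] [<-].
have [q1 [q2 [p1 [p2 [Ep Eq s12 Er D]]]]] := IHq p (red_behead rp) (red_behead rq).
exists q1, (f :: q2), (g :: p1), p2; split; rewrite /= ?Ep ?Eq ?s12 //.
  by rewrite fg einvK eqxx -Ep -Eq.
move=> f' g' hf'; rewrite rev_cons; case: (lastP p1) Ep s12 D => [|p1' g''].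
  move=> _ /size0nil q20 _ [<-]; move: rq; rewrite Eq q20 /=.
  by case: (q1) hf' => //= ? ? [->] /andP[]; rewrite fg einvK.
by move=> _ _ D; rewrite rev_rcons /= => -[<-]; apply: D => //; rewrite rev_rcons.
Qed.

(** So a stack of [size q] letters separates [p] from the result [r] in the
    tree of reduced stacks, in which [lcp] is the length of the common part. *)
Lemma foldl_push_size p q (r := foldl (fun s f => push f s) p q) :
  red p -> red q -> size p + size r = size q + (lcp (rev p) (rev r)).*2.
Proof.
rewrite /r => rp rq.
have [q1 [q2 [p1 [p2 [-> -> s12 -> D]]]]] := foldl_push_split rp rq.
have -> : lcp (rev (p1 ++ p2)) (rev (rev q1 ++ p2)) = size p2.
  rewrite !rev_cat revK lcp_cat size_rev; apply/eqP; rewrite -[X in _ == X]addn0 eqn_add2l.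
  case: (rev p1) q1 D => [|g ?] [|f ?] //= /(_ f g erefl erefl).
  by rewrite eq_sym => /negPf->.
by rewrite !size_cat size_rev s12; lia.
Qed.

End Stack.

(* Abstracting the values of [f] identifies those at convertible arguments. *)
Ltac nat_lia f :=
  intros;
  repeat match goal with
    | H : @eq nat _ _ |- _ => revert H
    | H : is_true (leq _ _) |- _ => revert H
    | H : is_true (odd _) |- _ => revert H
  end;
  repeat match goal with |- context [f ?x] => move: (f x) end;
  lia.

(** * The tree of an independent set *)

(** [K] is a set of pairwise non-adjacent vertices, all with the link [L]. The
    group is then an HNN extension of the subgroup generated by the other
    vertices, with stable letters [K] that all centralise the subgroup generated
    by [L]; the section studies it through its Bass-Serre tree, whose edges are
    the cosets of the latter subgroup, one family for each vertex in [K]. *)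
Definition common_link (V : finType) (e : rel V) (K L : {set V}) : Prop :=
  [/\ symmetric e, {in K &, forall u v, ~~ e u v} &
      {in K, forall k, lk e k = L}].

Section Tree.
Variables (V : finType) (e : rel V) (K L : {set V}).

Hypothesis KL : common_link e K L.
Let e_sym : symmetric e. Proof. by case: KL. Qed.
Let K_indep : {in K &, forall u v, ~~ e u v}. Proof. by case: KL. Qed.
Let K_link : {in K, forall k, lk e k = L}. Proof. by case: KL. Qed.
Local Notation A := (raag e).
Local Notation parab := (@parab V e).
Local Notation letter := (@letter V e).
Implicit Types (u v w : V) (a b : V * bool) (g h x y z p : A).

Definition tree_edge : eqType := (set A * V * bool)%type.
Definition flip (f : tree_edge) : tree_edge := (f.1, ~~ f.2).

Lemma flipK : involutive flip.
Proof. by case=> f []. Qed.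

Definition edge_coset g : set A := [set y | g^-1 * y \in parab L]%classic.

Lemma edge_coset_eq g h : (g^-1 * h \in parab L) <-> edge_coset g = edge_coset h.
Proof.
split=> [gh|/(congr1 (fun S : set A => S h))]; last first.
  by rewrite /edge_coset /= mulVg parab1 => ->.
apply/funext => y; apply/propext; rewrite /edge_coset /=.
by rewrite -(parabMl (h^-1 * y) gh) !gnorm.
Qed.

(** The oriented edge crossed when the letter [a] is read at the vertex [g];
    the orientation is the sign of [a], so that [a] and its inverse cross the
    same edge in opposite directions. *)
Definition edge_at g a : tree_edge := (edge_coset (if a.2 then g * letter a else g), a.1, a.2).

Lemma edge_at_flip g a : edge_at (g * letter a) (letter_inv a) = flip (edge_at g a).
Proof.
rewrite /edge_at letterV mulgK /flip /=.
by case: a => k [].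
Qed.

Definition read_state := (seq tree_edge * A)%type.

Definition read_letter (s : read_state) a : read_state :=
  (if a.1 \in K then push flip (edge_at s.2 a) s.1 else s.1, s.2 * letter a).

Definition read_word (w : word V) (s : read_state) := foldl read_letter s w.

Lemma read_word_cat (w1 w2 : word V) s : read_word (w1 ++ w2) s = read_word w2 (read_word w1 s).
Proof. exact: foldl_cat. Qed.

Lemma read_word_red (w : word V) s : red flip s.1 -> red flip (read_word w s).1.
Proof.
elim: w s => //= a w IHw s rs; apply: IHw => /=.
by case: ifP => // _; apply: push_red.
Qed.

Lemma read_word2 (w : word V) s : (read_word w s).2 = s.2 * raag_class e w.
Proof.
elim: w s => [|a w IHw] s /=; first by rewrite (mulg1 s.2).
by rewrite IHw /= -cat1s raag_classM mulgA.
Qed.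

(** Reading a word walks in the tree from the vertex [s.2]. Cancelling letters
    walk back and forth along one edge, letters outside [K] do not move, and a
    letter of the link does not change the coset that names the next edge. *)
Lemma read_word_eqv (w1 w2 : word V) : word_eqv e w1 w2 ->
  forall s, red flip s.1 -> read_word w1 s = read_word w2 s.
Proof.
elim=> {w1 w2} [//|w1 w2 _ IH|w1 w2 w3 _ IH1 _ IH2|w1 w2 w3 w4 _ IH1 _ IH2|a|u v uv] s rs.
- by rewrite IH.
- by rewrite IH1 ?IH2.
- by rewrite !read_word_cat IH1 // IH2 // read_word_red.
- case: s rs => p g /= rp; rewrite /read_letter /= letterV mulgK edge_at_flip.
  by case: ifP => aK; rewrite aK ?(pushKV flipK).
have Kuv u' v' : e u' v' -> u' \in K ->
    forall g, edge_at (g * letter (v', false)) (u', false) = edge_at g (u', false) /\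
              (v' \in K) = false.
  move=> u'v' u'K g; split; last first.
    by apply/negP => v'K; move: (K_indep u'K v'K); rewrite u'v'.
  congr (_, _, _); apply/esym/edge_coset_eq; rewrite /= mulKg parab_letter //=.
  by rewrite -(K_link u'K) inE.
case: s rs => p g /= rp; rewrite /read_letter /=.
have -> : g * letter (u, false) * letter (v, false) = g * letter (v, false) * letter (u, false).
  by rewrite -!mulgA; congr (_ * _); apply: letter_commute.
have [uK|uK] := boolP (u \in K).
  by have [-> ->] := Kuv _ _ uv uK g.
case: ifP => // vK.
by have [-> _] := Kuv _ _ (etrans (e_sym v u) uv) vK g.
Qed.

Definition path_to g := (read_word (repr g) ([::], 1)).1.

Lemma path_class (w : word V) : path_to (raag_class e w) = (read_word w ([::], 1)).1.
Proof. by rewrite /path_to (read_word_eqv (repr_raag_class e w)). Qed.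

(** The number of letters from [K] in a shortest word for [g]: the distance
    from the base vertex to its image by [g] in the tree. *)
Definition tlen g := size (path_to g).

Lemma path_red g : red flip (path_to g).
Proof. exact: read_word_red. Qed.

Lemma read_word_foldr (w : word V) (p : seq tree_edge) g : red flip p ->
  (read_word w (p, g)).1 = foldr (push flip) p (read_word w ([::], g)).1.
Proof.
move=> rp; elim/last_ind: w => //= w a IHw.
rewrite -cats1 !read_word_cat /= /read_letter /= !read_word2 /= IHw.
by case: ifP => // _; rewrite (push_foldr flipK) // read_word_red.
Qed.

Definition translate h (f : tree_edge) : tree_edge :=
  ((fun y => f.1.1 (h^-1 * y)) : set A, f.1.2, f.2).

Lemma translate_inj h : injective (translate h).
Proof.
move=> [[S k] i] [[T k'] j] [ST -> ->]; congr (_, _, _).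
apply/funext => y; have := congr1 (fun f => f (h * y)) ST.
by rewrite /= mulKg.
Qed.

Lemma read_word_translate h (w : word V) (p : seq tree_edge) g :
  read_word w (map (translate h) p, h * g) =
  (map (translate h) (read_word w (p, g)).1, h * (read_word w (p, g)).2).
Proof.
elim: w p g => //= a w IHw p g; rewrite /read_letter /= -!mulgA -IHw mulgA; congr read_word.
congr (_, _); case: ifP => // _.
have -> : edge_at (h * g) a = translate h (edge_at g a).
  rewrite /edge_at /translate /edge_coset /=; congr (_, _, _); apply/funext => y /=.
  by case: a.2; rewrite !invgM !mulgA.
case: p => //= f p; rewrite -[flip (translate _ _)]/(translate h (flip _)).
by rewrite (inj_eq (@translate_inj h)); case: ifP.
Qed.

(** The Gromov product based at the base vertex. *)
Definition gromov x y := lcp (rev (path_to x)) (rev (path_to y)).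

(** The distance between two vertices is measured by walking from one to the
    other, after a translation. *)
Lemma tlen_gromov x y : tlen x + tlen y = tlen (x^-1 * y) + (gromov x y).*2.
Proof.
pose w := word_inv (repr x) ++ repr y.
have wE : raag_class e w = x^-1 * y.
  by rewrite raag_classM -raag_inv_class !raag_reprK.
have Ey : path_to y = foldl (fun s f => push flip f s) (path_to x) (rev (read_word w ([::], x)).1).
  rewrite foldl_rev -read_word_foldr ?path_red // /w read_word_cat.
  have -> : read_word (word_inv (repr x)) (path_to x, x) = ([::], 1).
    rewrite (_ : (path_to x, x) = read_word (repr x) ([::], 1)).
      by rewrite -read_word_cat (read_word_eqv (word_mulV e (repr x))).
    by rewrite [RHS]surjective_pairing read_word2 /= raag_reprK mul1g.
  by [].
have -> : tlen (x^-1 * y) = size (rev (read_word w ([::], x)).1).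
  rewrite /tlen size_rev -wE path_class.
  by have := read_word_translate x w [::] 1; rewrite mulg1 /= => ->; rewrite size_map.
have r_red : red flip (rev (read_word w ([::], x)).1).
  rewrite /red rev_sorted; have : red flip (read_word w ([::], x)).1 by apply: read_word_red.
  by apply: sub_sorted => f g; rewrite -(inv_eq flipK) eq_sym.
by have := foldl_push_size flipK (path_red x) r_red; rewrite -Ey.
Qed.

Lemma gromov_le x y : gromov x y <= tlen x.
Proof. by rewrite -[tlen x]size_rev; apply: lcp_size. Qed.

Lemma gromovC x y : gromov x y = gromov y x.
Proof. exact: lcpC. Qed.

Lemma gromov_ultra x y z : minn (gromov x y) (gromov y z) <= gromov x z.
Proof. exact: lcp_ultra. Qed.

Lemma tlen1 : tlen 1 = 0.
Proof. by rewrite /tlen path_class. Qed.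

Lemma tlenV x : tlen x^-1 = tlen x.
Proof.
have := tlen_gromov x 1; have := gromov_le 1 x.
by rewrite (gromovC 1) tlen1 mulg1; lia.
Qed.

Lemma tlenM x y : tlen (x * y) <= tlen x + tlen y.
Proof. have := tlen_gromov x^-1 y; by rewrite invgK tlenV => ->; apply: leq_addr. Qed.

(** Reduced products are a local property: in a tree a path is a geodesic as
    soon as it does not backtrack. *)
Lemma tlen_local x y z : tlen (x * y) = tlen x + tlen y ->
  tlen (y * z) = tlen y + tlen z -> 0 < tlen y ->
  tlen (x * y * z) = tlen x + tlen y + tlen z.
Proof.
move=> xy yz y0.
have := tlen_gromov x^-1 y; rewrite invgK tlenV xy => Gxy.
have := tlen_gromov y (y * z); rewrite mulKg yz => Gyz.
have := tlen_gromov x^-1 (y * z); rewrite invgK tlenV yz mulgA => Gxz.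
have := gromov_ultra x^-1 (y * z) y; rewrite (gromovC (y * z)).
move: Gxy Gyz Gxz; move: (gromov x^-1 y) (gromov y _) (gromov x^-1 (y * z)).
nat_lia tlen.
Qed.

(** Two points on one geodesic from the base vertex. *)
Lemma tlen_prefix g x y : tlen g = tlen x + tlen (x^-1 * g) ->
  tlen g = tlen y + tlen (y^-1 * g) -> tlen x <= tlen y ->
  tlen (x^-1 * y) = tlen y - tlen x.
Proof.
move=> gx gy xy.
have := tlen_gromov x g; have := tlen_gromov y g; have := tlen_gromov x y.
have := gromov_ultra x g y; have := gromov_le x y; rewrite (gromovC g y).
by move: (gromov x y) (gromov x g) (gromov y g); nat_lia tlen.
Qed.

Lemma tlen_letter a : tlen (letter a) = (a.1 \in K).
Proof. by rewrite /tlen path_class /= /read_letter /=; case: ifP. Qed.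

Lemma tlen_parab p : p \in parab (~: K) -> tlen p = 0.
Proof.
elim/parab_ind => [|a g aK _ IH]; first exact: tlen1.
have := tlenM (letter a) g; rewrite IH tlen_letter; rewrite inE in aK.
by rewrite (negPf aK); nat_lia tlen.
Qed.

Lemma tlenMl p x : tlen p = 0 -> tlen (p * x) = tlen x.
Proof.
move=> p0; have := tlenM p x; have := tlenM p^-1 (p * x).
by rewrite mulKg tlenV p0; nat_lia tlen.
Qed.

Lemma tlenMr p x : tlen p = 0 -> tlen (x * p) = tlen x.
Proof.
by move=> p0; rewrite -tlenV invgM tlenMl ?tlenV.
Qed.

Lemma odd_tlenM_letter a g : odd (tlen (g * letter a)) = (a.1 \in K) (+) odd (tlen g).
Proof.
rewrite -(raag_reprK g) -raag_classM /tlen !path_class read_word_cat /= /read_letter /=.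
case: ifP => // _; case: (read_word _ _).1 => //= f p; case: ifP => //= _.
by rewrite negbK.
Qed.

Lemma link_commute a g : a.1 \in K -> g \in parab L -> commute (letter a) g.
Proof.
move=> aK; apply: commute_parab => v.
by rewrite -(K_link aK) inE => av; apply: (@letter_commute _ _ a (v, false)).
Qed.

(** The case of Britton's lemma with two stable letters. *)
Lemma tlen2 a b p : a.1 \in K -> b.1 \in K -> p \in parab (~: K) ->
  tlen (letter a * p * letter b) = 2 \/ b = letter_inv a /\ p \in parab L.
Proof.
move=> aK bK pK.
have [w wK <-] : exists2 w, all (fun a => a.1 \notin K) w & raag_class e w = p.
  move: pK; elim/parab_ind => [|c g]; first by exists [::].
  rewrite inE => cK _ [w wK <-]; exists (c :: w); first by rewrite /= cK.
  by rewrite -cat1s raag_classM.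
have read_word_w s : read_word w s = (s.1, s.2 * raag_class e w).
  elim: w wK s => [|c w IHw] /= => [_ [q g]|/andP[cK wK] s].
    by rewrite (mulg1 g).
  rewrite (IHw wK) /read_letter /= (negPf cK).
  by rewrite -[raag_class e (c :: w)]/(raag_class e ([:: c] ++ w)) raag_classM mulgA.
have -> : letter a * raag_class e w * letter b = raag_class e ([:: a] ++ (w ++ [:: b])).
  by rewrite !raag_classM mulgA.
rewrite /tlen path_class !read_word_cat /= read_word_w /read_letter /= aK bK mul1g.
set f := edge_at _ a; set f' := edge_at _ b.
rewrite /push; case: eqP => [/(congr1 flip)|_]; last by left.
rewrite flipK => E; right.
have ba : b = letter_inv a.
  by move: E; rewrite /f /f' /flip /edge_at; case: a {aK f} b {bK f'} => k i [k' j] [_ -> <-].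
split=> //; move: E; rewrite /f' /f -edge_at_flip ba => -[/edge_coset_eq].
rewrite letterV !mul1g mulgV /=; case: (~~ a.2); rewrite ?mulKg ?invg1 ?mul1g //.
move=> pL; have := link_commute aK pL; rewrite /commute mulgVK => /mulgI E.
by rewrite -E.
Qed.

Local Notation B := (parab (~: K)).
Local Notation reversal := (@reversal V e).

(** Induction on the number of letters of [K], along a shortest word. *)
Lemma tlen_ind (P : A -> Prop) :
  (forall p, p \in B -> P p) ->
  (forall p a g, p \in B -> a.1 \in K -> tlen (p * letter a * g) = (tlen g).+1 ->
    P g -> P (p * letter a * g)) ->
  forall g, P g.
Proof.
pose Q g := forall R : A -> Prop, (forall p, p \in B -> R p) ->
  (forall p a g, p \in B -> a.1 \in K -> tlen (p * letter a * g) = (tlen g).+1 ->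
    R g -> R (p * letter a * g)) -> R g.
suff QT : forall g, Q g by move=> P0 PS g; apply: QT.
have Q0 p : p \in B -> Q p by move=> pB R R0 _; apply: R0.
have QS p a g : p \in B -> a.1 \in K -> tlen (p * letter a * g) = (tlen g).+1 ->
    Q g -> Q (p * letter a * g).
  by move=> pB aK E Qg R R0 RS; apply: (RS) => //; exact: (Qg R).
pose R g := g \in B \/ exists p a h,
    [/\ p \in B, a.1 \in K, g = p * letter a * h, tlen g = (tlen h).+1 & Q h].
have Qcase g : Q g -> R g.
  move/(_ R); apply=> [p pB|p a h pB aK E [hB|[q [b [k [qB bK Eh El Qk]]]]]].
    by left.
    by right; exists p, a, h; split=> //; apply: Q0.
  right; exists p, a, h; split=> //; rewrite Eh; apply: QS; rewrite -?Eh //.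
have QB p g : p \in B -> Q g -> Q (p * g).
  move=> pB /Qcase[gB|[q [b [h [qB bK -> E Qh]]]]].
    by apply: Q0; apply: parabM.
  rewrite !mulgA.
  have pE : tlen (p * q * letter b * h) = (tlen h).+1.
    by rewrite -E -!mulgA tlenMl // tlen_parab.
  by apply: QS => //; apply: parabM.
elim/raag_ind => [|a g Qg]; first by apply: Q0; apply: parab1.
have [aK|aK] := boolP (a.1 \in K); last by apply: QB; rewrite ?parab_letter // inE.
have Q1 : tlen (letter a * g) = (tlen g).+1 -> Q (letter a * g).
  by rewrite -[letter a]mul1g => E; apply: QS => //; apply: parab1.
case: (Qcase g Qg) => [gB|[p [b [h [pB bK Eg El Qh]]]]].
  by apply: Q1; rewrite tlenMr ?tlen_letter ?aK tlen_parab.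
have [E2|[ba pL]] := @tlen2 a b p aK bK pB; last first.
  rewrite Eg -(link_commute bK pL) ba letterV !mulgA mulgV mul1g.
  exact: QB.
apply: Q1; rewrite Eg -!mulgA (mulgA p).
have pb : tlen (p * letter b) = 1%N by rewrite tlenMl ?tlen_letter ?bK // tlen_parab.
rewrite mulgA tlen_local ?pb ?tlen_letter ?aK //; first by rewrite -Eg El.
  by rewrite mulgA.
by rewrite -Eg El.
Qed.

Lemma tlen0_parab g : tlen g = 0 -> g \in B.
Proof. by elim/tlen_ind: g => [p //|p a g _ _ -> _]. Qed.

Lemma tlen_syllable p a g : p \in B -> a.1 \in K -> tlen (p * letter a * g) <= (tlen g).+1.
Proof.
move=> pB aK; rewrite -mulgA (tlenMl _ (tlen_parab pB)).
by have := tlenM (letter a) g; rewrite tlen_letter aK add1n.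
Qed.

Lemma tlen_rev g : tlen (reversal g) = tlen g.
Proof.
have le h : tlen (reversal h) <= tlen h.
  elim/tlen_ind: h => [p pB|p a h pB aK -> IH]; first by rewrite tlen_parab ?parab_rev.
  rewrite !reversalM reversal_letter; apply: leq_trans (tlenM _ _) _.
  rewrite tlenMr; last by rewrite tlen_parab ?parab_rev.
  by rewrite tlen_letter aK addn1.
by apply/eqP; rewrite eqn_leq le -{1}(@reversalK _ _ g) le.
Qed.

Lemma tlen_ret (S : {set V}) g : K \subset S -> tlen (ret S g) <= tlen g.
Proof.
move=> KS; elim/tlen_ind: g => [p pB|p a h pB aK -> IH].
  by rewrite (tlen_parab (parab_ret S pB)).
rewrite !retM ret_letter (subsetP KS) //.
by apply: leq_trans (tlen_syllable _ (parab_ret S pB) aK) _.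
Qed.

Lemma tlen_split g n : n < tlen g ->
  exists x a y, [/\ g = x * letter a * y, a.1 \in K, tlen x = n &
    tlen g = (tlen x + tlen y).+1].
Proof.
elim/tlen_ind: g n => [p pB n|p a h pB aK E IH [|n]]; first by rewrite tlen_parab.
  by move=> _; exists p, a, h; split; rewrite ?(tlen_parab pB).
rewrite E ltnS => /IH[x [b [y [Eh bK xn Ey]]]].
have E1 : tlen (p * letter a * x) = n.+1.
  apply/eqP; rewrite eqn_leq -{1}xn tlen_syllable //=.
  have := tlenM (p * letter a * x * letter b) y; have := tlenM (p * letter a * x) (letter b).
  rewrite -!mulgA in E *; rewrite (mulgA x) -Eh E tlen_letter bK Ey xn.
  by nat_lia tlen.
exists (p * letter a * x), b, y; split=> //; first by rewrite Eh !mulgA.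
by rewrite E1 Ey xn.
Qed.

Lemma tlen_split_parab (S : {set V}) g n : K \subset S -> g \in parab S -> n < tlen g ->
  exists x a y, [/\ g = x * letter a * y, a.1 \in K, x \in parab S, y \in parab S &
    tlen x = n /\ tlen g = (tlen x + tlen y).+1].
Proof.
move=> KS gS /tlen_split[x [a [y [Eg aK xn El]]]].
have Eg' : g = ret S x * letter a * ret S y.
  by rewrite -{1}(parabP _ _ gS) Eg !retM ret_letter (subsetP KS).
exists (ret S x), a, (ret S y); rewrite !ret_parab; split=> //.
have := tlen_ret x KS; have := tlen_ret y KS.
have := tlenM (ret S x * letter a) (ret S y); have := tlenM (ret S x) (letter a).
rewrite -Eg' tlen_letter aK El xn => l1 l2 l3 l4.
have := leq_trans l2 (leq_add l1 l3).
have : tlen (ret S x) <= n by [].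
move: l1 l2 l3 l4; rewrite -xn.
move: (tlen (ret S x)) (tlen (ret S y)) (tlen (ret S x * letter a)) (tlen x) (tlen y).
by move=> *; split; lia.
Qed.

Lemma odd_tlen g : odd (tlen g) = par K g.
Proof.
elim/raag_ind: g => [|a g IHg]; first by rewrite tlen1 par1.
by rewrite -tlenV invgM -letterV odd_tlenM_letter tlenV IHg parM par_letter.
Qed.

(** A word can be cut at a reduced syllable [a p b]. *)
Lemma tlen_join x a p b y : a.1 \in K -> b.1 \in K -> p \in B ->
  tlen (x * letter a) = (tlen x).+1 -> tlen (letter b * y) = (tlen y).+1 ->
  tlen (letter a * p * letter b) = 2 ->
  tlen (x * letter a * p * letter b * y) = (tlen x + tlen y).+2.
Proof.
move=> aK bK /tlen_parab p0 xa yb ab.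
have a1 : tlen (letter a) = 1%N by rewrite tlen_letter aK.
have b1 : tlen (letter b) = 1%N by rewrite tlen_letter bK.
have E : tlen (x * letter a * (p * letter b)) = (tlen x).+2.
  rewrite tlen_local ?a1 ?xa ?(tlenMl _ p0) ?b1 ?addn1 //.
  by rewrite mulgA ab.
have xap : tlen (x * letter a * p) = (tlen x).+1 by rewrite (tlenMr _ p0).
rewrite tlen_local ?b1 ?xap ?yb ?addn1 ?addSn //.
by rewrite -mulgA E.
Qed.

(** A palindrome is cyclically reduced: it starts and ends with the same letter
    of [K]. *)
Lemma tlen_palindrome_sqr x : reversal x = x -> tlen (x * x) = (tlen x).*2.
Proof.
move=> xP; have [x0|x0] := posnP (tlen x); first by rewrite tlenMl x0.
have [p [a [y [Ex aK p0 Ey]]]] := tlen_split x0.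
have qB : reversal p * p \in B by rewrite parabM ?parab_rev ?tlen0_parab.
have Ey' : tlen (letter a * y) = (tlen y).+1.
  by rewrite -(tlenMl _ p0) mulgA -Ex Ey p0.
have Ery : tlen (reversal y * letter a) = (tlen y).+1.
  by rewrite -reversal_letter -reversalM tlen_rev Ey'.
have E2 : tlen (letter a * (reversal p * p) * letter a) = 2.
  by case: (tlen2 aK aK qB) => // -[]; case: (a) => ? [].
have -> : x * x = reversal y * letter a * (reversal p * p) * letter a * y.
  by rewrite -{1}xP Ex !reversalM reversal_letter !mulgA.
by rewrite tlen_join ?Ey ?p0 ?tlen_rev // addnn.
Qed.

(** The letter in the middle of a palindrome with an odd number of letters
    from [K]. Both [h] and the reversal of what follows [a] are the first half
    of [x], so they differ by an element [q] which passes through [a]. *)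
Lemma palindrome_middle (S : {set V}) x : K \subset S -> x \in parab S ->
  reversal x = x -> par K x ->
  exists h a q, [/\ x = h * letter a * q * reversal h, a.1 \in K,
    tlen x = (tlen h).*2.+1, h \in parab S &
    [/\ q \in parab S, q \in parab L & reversal q = q]].
Proof.
move=> KS xS xP; rewrite -odd_tlen => xodd.
pose n := (tlen x)./2.
have xn : tlen x = n.*2.+1 by rewrite -(odd_double_half (tlen x)) xodd.
have nx : n < tlen x by rewrite xn ltnS -addnn leq_addr.
have [h [a [r [Ex aK hn Er]]]] := tlen_split nx.
have rn : tlen r = n by move: Er; rewrite hn xn -addnn => -[/addnI].
have Ex' : x = reversal r * letter a * reversal h.
  by rewrite -{1}xP Ex !reversalM reversal_letter mulgA.
have prefix y z : x = y * letter a * z -> tlen y = n -> tlen z = n ->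
    tlen x = tlen y + tlen (y^-1 * x).
  move=> E yn zn; have := tlenM y (y^-1 * x); rewrite mulVKg.
  have : tlen (y^-1 * x) <= n.+1.
    by rewrite E -!mulgA mulKg (leq_trans (tlenM _ _)) // tlen_letter aK zn.
  by rewrite xn yn; nat_lia tlen.
set q := h^-1 * reversal r.
have q0 : tlen q = 0.
  rewrite /q (@tlen_prefix x) ?tlen_rev ?hn ?rn ?subnn //.
    by rewrite -hn; apply: prefix Ex _ _.
  by rewrite -rn -(tlen_rev r); apply: prefix Ex' _ _; rewrite tlen_rev.
have qB := tlen0_parab q0.
have Er' : reversal r = h * q by rewrite /q mulVKg.
have aq : letter a * reversal q = q * letter a.
  have E : h * letter a * reversal q * reversal h = h * q * letter a * reversal h.
    by rewrite -Er' -Ex' Ex -(reversalK r) Er' reversalM !mulgA.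
  by move/mulIg: E; rewrite -!mulgA => /mulgI.
have qL : q \in parab L.
  have [|[]//] := tlen2 (a := letter_inv a) aK aK qB.
  by rewrite -mulgA -aq letterV mulKg tlen_rev q0.
have qP : reversal q = q.
  by apply: (@mulgI _ (letter a)); rewrite aq (link_commute aK qL).
have Eh : x = ret S h * letter a * ret S q * reversal (ret S h).
  rewrite -(parabP _ _ xS) {1}Ex -{1}(reversalK r) Er' reversalM qP !retM.
  by rewrite ret_letter (subsetP KS) // reversal_ret !mulgA.
exists (ret S h), a, (ret S q); split; rewrite ?ret_parab //.
- have q'0 : tlen (ret S q) = 0 by rewrite (tlen_parab (parab_ret S qB)).
  apply/eqP; rewrite eqn_leq; apply/andP; split; last first.
    by rewrite xn ltnS leq_double -hn tlen_ret.
  rewrite {1}Eh (leq_trans (tlenM _ _)) // tlen_rev (tlenMr _ q'0) -addnn -addSn leq_add2r.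
  by rewrite (leq_trans (tlenM _ _)) // tlen_letter aK addn1.
- by split; rewrite ?ret_parab ?parab_ret // reversal_ret qP.
Qed.

(** ** The centraliser of a palindrome *)

(** An element of the base vertex group that commutes with [x] fixes the first
    edge of the axis of [x]. *)
Lemma commute_first_edge x y a p : p \in B -> a.1 \in K -> y \in B ->
  tlen (p * letter a * x) = (tlen x).+1 -> commute y (p * letter a * x) ->
  p^-1 * y * p \in parab L.
Proof.
move=> pB aK yB pax yC; set z := p^-1 * y * p.
have zB : z \in B by rewrite !parabM ?parabV.
have [E2|[]//] := tlen2 (a := letter_inv a) aK aK zB.
have Ey : y = x^-1 * letter (letter_inv a) * z * letter a * x.
  have -> : y = (p * letter a * x)^-1 * y * (p * letter a * x).
    by rewrite -mulgA yC mulKg.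
  by rewrite /z letterV !gnorm.
have ax : tlen (letter a * x) = (tlen x).+1.
  by rewrite -pax -mulgA (tlenMl _ (tlen_parab pB)).
have xa : tlen (x^-1 * letter (letter_inv a)) = (tlen x^-1).+1.
  by rewrite letterV -invgM !tlenV.
by have := tlen_parab yB; rewrite Ey tlen_join.
Qed.
End Tree.

(** * Centralisers of palindromes *)

Section Axis.
Variables (V : finType) (e : rel V).
Hypotheses (e_sym : symmetric e) (e_irr : irreflexive e).
Local Notation A := (raag e).
Local Notation parab := (@parab V e).
Local Notation letter := (@letter V e).
Local Notation reversal := (@reversal V e).
Implicit Types (u v w s : V) (a b : V * bool) (g h x y : A).

Lemma vertex_link u : common_link e [set u] (lk e u).
Proof. by split=> // [v w|v] /set1P-> // /set1P->; rewrite e_irr. Qed.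

Variables (u : V) (x : A).
Hypotheses (xP : reversal x = x) (x_u : x \notin parab [set~ u]).

Local Notation K := [set u].
Local Notation L := (lk e u).
Local Notation len := (tlen K L).
Let KL := vertex_link u.

Let x_gt0 : 0 < len x.
Proof.
by rewrite lt0n; apply: contra x_u => /eqP x0; have := tlen0_parab KL x0.
Qed.

Let len_sqr : len (x * x) = len x + len x.
Proof. by rewrite addnn; apply: tlen_palindrome_sqr. Qed.

Let len_expg n : len (x ^+ n) = (n * len x)%N.
Proof.
suff [] : len (x ^+ n) = (n * len x)%N /\ len (x ^+ n.+1) = (n.+1 * len x)%N by [].
elim: n => [|n [IH1 IH2]]; first by rewrite expg0 expg1 (tlen1 KL) mul1n.
split=> //; rewrite !expgS mulgA (tlen_local KL) // -?expgS ?IH1 ?IH2 ?mulSn ?addnA //.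
Qed.

(** [y] translates the axis of [x] in the direction of [x]. *)
Let forward y := len (y * x) = len y + len x.

Let forward_expg y n : forward y -> len (y * x ^+ n) = len y + (n * len x)%N.
Proof.
move=> yx; case: n => [|n]; first by rewrite mulg1 addn0.
rewrite expgS mulgA (tlen_local KL) // -?expgS ?len_expg ?mulSn ?addnA //.
Qed.

(** An element that commutes with [x] translates its axis, hence cannot cancel
    both against [x] and against its inverse. *)
Let forwardP y : commute y x -> 0 < len y -> forward y \/ forward y^-1.
Proof.
move=> yC y0.
have [q [c [z [Ey cK qn Ez]]]] : exists q c z, [/\ y = q * letter c * z, c.1 \in K,
    len q = (len y).-1 & len y = (len q + len z).+1].
  by apply: tlen_split; rewrite ?prednK.
have z0 : len z = 0.
  by move: Ez; rewrite qn -{1}(prednK y0) => -[/esym/(canRL (addKn _))]; rewrite subnn.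
have [p [a [r [Ex aK p0 Er]]]] := tlen_split KL x_gt0.
have Ex' : x = reversal r * letter a * reversal p.
  by rewrite -{1}xP Ex !reversalM reversal_letter mulgA.
have [pB zB] := (tlen0_parab KL p0, tlen0_parab KL z0).
have qc : len (q * letter c) = (len q).+1.
  by rewrite -(tlenMr KL _ z0) -Ey Ez z0 addn0.
have ar : len (letter a * r) = (len r).+1.
  by rewrite -(tlenMl KL _ p0) mulgA -Ex Er p0.
have ar' : len (letter (letter_inv a) * (reversal r)^-1) = (len (reversal r)^-1).+1.
  by rewrite letterV -invgM !(tlenV KL) -reversal_letter -reversalM !(tlen_rev KL) ar.
have [ca|ca] := eqVneq c (letter_inv a).
  right; rewrite /forward -(tlenV KL) invgM invgK.
  have -> : x^-1 * y =
      q * letter c * (z * (reversal p)^-1) * letter (letter_inv a) * (reversal r)^-1.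
    by rewrite (commute_sym (commuteV (yC))) {1}Ex' Ey letterV !gnorm.
  rewrite (tlen_join KL) // ?parabM ?parabV ?parab_rev //; last first.
    have zpB : z * (reversal p)^-1 \in parab [set~ u] by rewrite parabM ?parabV ?parab_rev.
    have [//|[ac]] := tlen2 KL (b := letter_inv a) cK aK zpB.
    by move: ac; rewrite ca letter_invK; case: (a) => ? [].
  rewrite !(tlenV KL) (tlen_rev KL) Ez z0 Er p0. lia.
left; rewrite /forward.
have -> : y * x = q * letter c * (z * p) * letter a * r by rewrite Ey Ex !mulgA.
rewrite (tlen_join KL) // ?parabM ?Ez ?z0 ?Er ?p0 ?addn0 ?addSn ?addnS //.
have [//|[ac]] := tlen2 KL cK aK (parabM zB pB).
by rewrite ac letter_invK eqxx in ca.
Qed.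

Let forward_quotient (y z : A) : commute y x -> commute z x -> forward y -> forward z ->
  len z <= len y -> len (z^-1 * y) = len y - len z.
Proof.
move=> yC zC yF zF zy; have yX : len y <= len (x ^+ len y).
  by rewrite len_expg leq_pmulr.
have prefix t : commute t x -> forward t -> len t <= len (x ^+ len y) ->
    len (x ^+ len y) = len t + len (t^-1 * x ^+ len y).
  move=> tC tF tX; pose g := x ^+ len y * t.
  have gE : len g = len t + len (x ^+ len y).
    by rewrite /g -(commuteX _ tC) forward_expg // len_expg.
  rewrite (@tlen_prefix _ _ _ _ KL g) ?subnKC //.
    by rewrite /g -(commuteX _ tC) mulKg -gE /g -(commuteX _ tC).
  by rewrite /g mulKg -/g gE addnC.
by apply: (tlen_prefix KL (g := x ^+ len y)) => //; apply: prefix => //; apply: leq_trans yX.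
Qed.

(** The centraliser of [x] translates the axis of [x], and what fixes the axis
    lies in a conjugate of the subgroup generated by the link of [u]. So outside
    this link all exponents on the centraliser are multiples of one character. *)
Lemma centraliser_par : exists y0, forall y, commute y x ->
  exists b : bool, forall s, s \notin L -> par [set s] y = b && par [set s] y0.
Proof.
(* [y0] is a forward translation of least positive length. *)
pose C n := `[< exists y, [/\ commute y x, len y = n & 0 < n] >].
have exC : exists n, C n by exists (len x); apply/asboolP; exists x.
case: (ex_minnP exC) => n /asboolP[z [zC zn n0]] nmin.
have [y0 [y0C y0n y0F]] : exists y0, [/\ commute y0 x, len y0 = n & forward y0].
  have [|zF|zF] := forwardP zC; first by rewrite zn.
    by exists z.
  by exists z^-1; split; rewrite ?(tlenV KL) //; apply/commute_sym/commuteV/commute_sym.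
exists y0 => y; have [m] := ubnP (len y); elim: m y => // m IHm y; rewrite ltnS => ym yC.
have [yl|yl] := posnP (len y).
  exists false => s sL; have yB := tlen0_parab KL yl.
  have [p [a [r [Ex aK p0 Er]]]] := tlen_split KL x_gt0.
  have pB := tlen0_parab KL p0.
  have := commute_first_edge KL (x := r) pB aK yB; rewrite -Ex Er p0 => /(_ erefl yC) pL.
  have : par [set s] (p^-1 * y * p) = false.
    by apply: par_parab pL; rewrite disjoints1.
  by rewrite !parM parV addbAC addbb.
have nE : n <= len y by apply: nmin; apply/asboolP; exists y.
have main z' : commute z' x -> len z' = len y -> forward z' ->
    exists b : bool, forall s, s \notin L -> par [set s] z' = b && par [set s] y0.
  move=> z'C z'n z'F; have := forward_quotient z'C y0C z'F y0F.
  rewrite y0n z'n => /(_ nE) E.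
  have [||b bE] := IHm (y0^-1 * z').
  - by rewrite E; apply: leq_trans ym; rewrite ltn_subrL n0.
  - by apply/commute_sym/commuteM; [apply/commuteV/commute_sym|apply/commute_sym].
  exists (~~ b) => s sL; have := bE s sL; rewrite parM parV.
  by case: (par _ y0); case: (par _ z'); case: (b).
have [yF|yF] := forwardP yC yl; first exact: main.
have [||b bE] := main y^-1 _ _ yF.
- by apply/commute_sym/commuteV/commute_sym.
- exact: (tlenV KL).
by exists b => s sL; rewrite -bE // parV.
Qed.

Lemma centraliser_par_disjoint s t y z : commute y x -> commute z x ->
  s \notin L -> t \notin L -> par [set s] y -> par [set t] z ->
  par [set t] y = false -> False.
Proof.
move=> yC zC sL tL; have [y0 y0P] := centraliser_par.
have [b bP] := y0P y yC; have [c cP] := y0P z zC.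
rewrite !bP // cP // => /andP[-> _] /andP[_ ->]; done.
Qed.

End Axis.

Section Support.
Variables (V : finType) (e : rel V).
Hypotheses (e_sym : symmetric e) (e_irr : irreflexive e).
Local Notation A := (raag e).
Local Notation parab := (@parab V e).
Local Notation reversal := (@reversal V e).

Definition up (v : V) : {set V} := [set u | dominated e v u].

Definition pure (f : aut A) : Prop :=
  centraliser (raag_iota e) f /\ forall S g, par S (f g) = par S g.

(** If [u] occurs in [f v] without dominating [v], because of some [w] in the
    link of [v], then the centraliser of [f v] contains two elements whose odd
    exponents are incompatible: [f w] and either [f v] or [f u]. *)
Lemma pure_support (f : aut A) v : pure f -> f (gen e v) \in parab (up v).
Proof.
move=> [fC fpar]; apply: parab_support => u; rewrite inE => /subsetPn[w].
rewrite !inE negb_or => vw /andP[wu uw]; apply/negPn/negP => fvu.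
have fP : reversal (f (gen e v)) = f (gen e v).
  by rewrite -centraliser_rev // reversal_gen.
have comm t : e v t -> commute (f (gen e t)) (f (gen e v)).
  by move=> vt; rewrite /commute -!autM; congr (f _); apply/commute_sym/gen_commute.
have [vu|vu] := boolP (e v u).
  apply: (centraliser_par_disjoint e_sym e_irr fP fvu (comm u vu) (comm w vw) (s := u) (t := w)).
  - by rewrite inE e_irr.
  - by rewrite inE.
  - by rewrite fpar par_gen set11.
  - by rewrite fpar par_gen set11.
  - by rewrite fpar par_gen inE eq_sym (negPf wu).
have vw' : (w == v) = false by apply: contraTF vw => /eqP ->; rewrite e_irr.
apply: (centraliser_par_disjoint e_sym e_irr fP fvu (commute_refl _) (comm w vw) (s := v) (t := w)).
- by rewrite inE e_sym.
- by rewrite inE.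
- by rewrite fpar par_gen set11.
- by rewrite fpar par_gen set11.
- by rewrite fpar par_gen inE eq_sym.
Qed.

End Support.

(** * The generators *)

Section SubgroupGen.
Variables (G : groupType) (S : set G).

Lemma subgroup_gen_sub x : S x -> subgroup_gen S x.
Proof. by move=> Sx H [_]; apply. Qed.

Lemma subgroup_gen1 : subgroup_gen S 1.
Proof. by move=> H [[/set_mem]]. Qed.

Lemma subgroup_genF x y : subgroup_gen S x -> subgroup_gen S y ->
  subgroup_gen S (x / y).
Proof.
move=> Sx Sy H HS; have [[_ HF] _] := HS.
by apply/set_mem/HF; apply/mem_set; [apply: (Sx _ HS) | apply: (Sy _ HS)].
Qed.

Lemma subgroup_genV x : subgroup_gen S x -> subgroup_gen S x^-1.
Proof. by move=> Sx; rewrite -[x^-1]mul1g; apply: subgroup_genF subgroup_gen1 Sx. Qed.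

Lemma subgroup_genM x y : subgroup_gen S x -> subgroup_gen S y ->
  subgroup_gen S (x * y).
Proof.
by move=> Sx Sy; rewrite -[y]invgK; apply: subgroup_genF => //; apply: subgroup_genV.
Qed.

Lemma subgroup_gen_centraliser x : (S `<=` centraliser x)%classic ->
  (subgroup_gen S `<=` centraliser x)%classic.
Proof.
move=> SC y; apply; split=> //; split; first exact/mem_set/commute1.
by move=> y1 y2 /set_mem C1 /set_mem C2; apply/mem_set/commuteM => //; apply: commuteV.
Qed.

End SubgroupGen.

Section Generators.
Variables (V : finType) (e : rel V).
Hypotheses (e_sym : symmetric e) (e_irr : irreflexive e).
Local Notation A := (raag e).
Local Notation parab := (@parab V e).
Local Notation letter := (@letter V e).
Local Notation gen := (gen e).
Local Notation reversal := (@reversal V e).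
Implicit Types (u v w i j k : V) (a b : V * bool) (g h p q x y : A) (f : aut A).

Lemma aut_gen_ext f f' : (forall v, f (gen v) = f' (gen v)) -> f = f'.
Proof. by move=> ff'; apply/aut_ext/raag_morph_ext => //; apply: autM. Qed.

Lemma aut1 f : f 1 = 1. Proof. exact: morph1 (@autM _ f). Qed.
Lemma autV f x : f x^-1 = (f x)^-1. Proof. exact: morphV (@autM _ f) x. Qed.

Lemma aut_letter f a : f (letter a) = if a.2 then (f (gen a.1))^-1 else f (gen a.1).
Proof. by case: a => v []; rewrite ?letter_genV ?autV. Qed.

Lemma aut_fix f (S : {set V}) : (forall v, v \in S -> f (gen v) = gen v) ->
  forall g, g \in parab S -> f g = g.
Proof.
move=> fS g; elim/parab_ind => [|[v i] h /= vS _ IH]; first exact: aut1.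
by rewrite autM IH aut_letter /= fS //; case: i; rewrite -?letter_genV.
Qed.

Lemma aut_invE f x y : (f^-1) x = y <-> x = f y.
Proof. by split=> [<-|->]; rewrite -autME ?mulgV ?mulVg. Qed.

Lemma aut_exists (phi psi : V -> A) :
  (forall u v, e u v -> commute (phi u) (phi v)) ->
  (forall u v, e u v -> commute (psi u) (psi v)) ->
  (forall v, raag_lift phi (psi v) = gen v) ->
  (forall v, raag_lift psi (phi v) = gen v) ->
  exists f, forall v, f (gen v) = phi v.
Proof.
move=> phiC psiC phiK psiK.
have K1 : cancel (@raag_lift _ e _ phi) (@raag_lift _ e _ psi).
  apply: (@raag_morph_ext _ _ _ (raag_lift psi \o raag_lift phi) id) => // [x y|v] /=.
    by rewrite !raag_liftM.
  by rewrite (raag_lift_gen phiC).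
have K2 : cancel (@raag_lift _ e _ psi) (@raag_lift _ e _ phi).
  apply: (@raag_morph_ext _ _ _ (raag_lift phi \o raag_lift psi) id) => // [x y|v] /=.
    by rewrite !raag_liftM.
  by rewrite (raag_lift_gen psiC).
have fP : is_aut (@raag_lift _ e _ phi).
  by split; [apply: raag_liftM | exists (raag_lift psi)].
by exists (mk_aut fP) => v; apply: raag_lift_gen.
Qed.

Lemma inversion_exists j : exists f, is_inversion j f.
Proof.
pose phi v := if v == j then (gen v)^-1 else gen v.
have phiC u v : e u v -> commute (phi u) (phi v).
  move=> /gen_commute uv; rewrite /phi.
  have {}uv : commute (gen u) (if v == j then (gen v)^-1 else gen v).
    by case: ifP => // _; apply: commuteV.
  by case: ifP => // _; apply/commute_sym/commuteV/commute_sym.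
have phiK v : raag_lift phi (phi v) = gen v.
  rewrite {2}/phi; case: ifP => vj; rewrite ?(morphV (raag_liftM phiC));
  rewrite (raag_lift_gen phiC) /phi vj //.
  exact: invgK.
have [f fE] := aut_exists phiC phiC phiK phiK.
by exists f; split=> [|k kj]; rewrite fE /phi ?eqxx ?(negPf kj).
Qed.

Lemma diagram_exists (s : {perm V}) : {mono s : u v / e u v} ->
  exists f, forall v, f (gen v) = gen (s v).
Proof.
move=> sM.
have sC u v : e u v -> commute (gen (s u)) (gen (s v)).
  by move=> uv; apply: gen_commute; rewrite sM.
have s'C u v : e u v -> commute (gen (s^-1%g u)) (gen (s^-1%g v)).
  by move=> uv; apply: gen_commute; rewrite -sM !permKV.
by apply: (aut_exists sC s'C) => v; rewrite raag_lift_gen // ?permK ?permKV.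
Qed.

(** [p v q] may replace [v] as soon as [p] and [q] avoid [v] and centralise its
    link. This covers transvections and palindromic automorphisms. *)
Lemma sandwich_exists i p q : p \in parab [set~ i] -> q \in parab [set~ i] ->
  (forall w, e i w -> commute p (gen w)) -> (forall w, e i w -> commute q (gen w)) ->
  exists f, f (gen i) = p * gen i * q /\ forall k, k != i -> f (gen k) = gen k.
Proof.
move=> pi qi pC qC; pose phi p q v := if v == i then p * gen i * q else gen v.
have phiC p' q' : (forall w, e i w -> commute p' (gen w)) ->
    (forall w, e i w -> commute q' (gen w)) ->
    forall u v, e u v -> commute (phi p' q' u) (phi p' q' v).
  move=> pC' qC'.
  have C w : e i w -> commute (p' * gen i * q') (gen w).
    move=> iw; apply/commute_sym/commuteM; last exact/commute_sym/qC'.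
    by apply: commuteM; apply/commute_sym; [apply: pC' | apply: gen_commute].
  move=> u v uv; rewrite /phi; case: eqP => [ui|_]; case: eqP => [vi|_] //.
  - by apply: C; rewrite -ui.
  - by apply/commute_sym/C; rewrite -vi e_sym.
  - exact: gen_commute.
have phi_fix p' q' (C : forall u v, e u v -> commute (phi p' q' u) (phi p' q' v)) x :
    x \in parab [set~ i] -> raag_lift (phi p' q') x = x.
  elim/parab_ind => [|[v b] h]; first by rewrite (morph1 (raag_liftM C)).
  rewrite !inE /= => vi _ IH; rewrite (raag_liftM C) IH; congr (_ * _).
  case: b; rewrite ?letter_genV ?letter_gen ?(morphV (raag_liftM C)) (raag_lift_gen C);
  by rewrite /phi (negPf vi).
have pC' w : e i w -> commute p^-1 (gen w).
  by move=> iw; apply/commute_sym/commuteV/commute_sym/pC.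
have qC' w : e i w -> commute q^-1 (gen w).
  by move=> iw; apply/commute_sym/commuteV/commute_sym/qC.
have C := phiC p q pC qC; have C' := phiC p^-1 q^-1 pC' qC'.
have [||f fE] := aut_exists C C'.
- move=> v; rewrite {2}/phi; case: eqP => [->|vi]; last first.
    by rewrite (raag_lift_gen C) /phi; case: eqP.
  rewrite !(raag_liftM C) (raag_lift_gen C) !(phi_fix _ _ C) ?parabV //.
  by rewrite /phi eqxx !gnorm.
- move=> v; rewrite {2}/phi; case: eqP => [->|vi]; last first.
    by rewrite (raag_lift_gen C') /phi; case: eqP.
  rewrite !(raag_liftM C') (raag_lift_gen C') !(phi_fix _ _ C') //.
  by rewrite /phi eqxx !gnorm.
by exists f; split=> [|k ki]; rewrite fE /phi ?eqxx ?(negPf ki).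
Qed.

Definition generated := subgroup_gen (diagram_auts e `|` adjacent_dominated_transvections e
                `|` inversions e `|` dominated_elem_palindromics e)%classic.

Lemma dominated_commute i j w : dominated e i j -> e i w -> commute (gen j) (gen w).
Proof.
move=> /subsetP/(_ w); rewrite !inE => ij iw.
by have /orP[/eqP->|/gen_commute C] := ij iw; [apply: commute_refl | apply: C].
Qed.

Lemma diagram_gen f (s : {perm V}) : {mono s : u v / e u v} ->
  (forall v, f (gen v) = gen (s v)) -> generated f.
Proof. by move=> sM fE; apply: subgroup_gen_sub; do 3!left; exists s. Qed.

Lemma inversion_gen j f : is_inversion j f -> generated f.
Proof. by move=> fP; apply: subgroup_gen_sub; left; right; exists j. Qed.

Lemma adjacent_transvection i j : e i j -> dominated e i j ->
  exists f, is_transvection i j f /\ generated f.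
Proof.
move=> eij ij; have nij : i != j by apply: contraTneq eij => ->; rewrite e_irr.
have [||||f [fi fk]] := @sandwich_exists i 1 (gen j).
- exact: parab1.
- by apply: parab_gen; rewrite !inE eq_sym.
- by move=> w _; apply/commute_sym/commute1.
- by move=> w; apply: dominated_commute.
have fP : is_transvection i j f by split=> //; rewrite fi mul1g.
exists f; split=> //; apply: subgroup_gen_sub; do 2!left; right; exists i, j; split=> //.
by apply/eqP/commgP/gen_commute.
Qed.

(** The automorphism [v -> h v h^rev], for [h] in the group generated by the
    vertices that dominate [v], is a product of elementary palindromic
    automorphisms, one for each letter of [h]. *)
Lemma sandwich_gen i h : h \in parab (up e i :\ i) ->
  exists f, [/\ f (gen i) = h * gen i * reversal h,
    forall k, k != i -> f (gen k) = gen k & generated f].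
Proof.
elim/parab_ind => [|[j b] h']; last rewrite !inE /= => /andP[ji ij] h'i [f [fi fk fG]].
  exists 1; split=> [|//|]; last exact: subgroup_gen1.
  by rewrite reversal1 mul1g mulg1.
have fj : f (gen j) = gen j by apply: fk.
have [||||g [gi gk]] := @sandwich_exists i (gen j) (gen j).
- by apply: parab_gen; rewrite !inE.
- by apply: parab_gen; rewrite !inE.
- by move=> w; apply: dominated_commute.
- by move=> w; apply: dominated_commute.
have gG : generated g.
  by apply: subgroup_gen_sub; right; exists i, j; rewrite eq_sym.
have g'i : g^-1 (gen i) = (gen j)^-1 * gen i * (gen j)^-1.
  by apply/aut_invE; rewrite !autM autV gi gk // !gnorm.
have g'k k : k != i -> g^-1 (gen k) = gen k by move=> ki; apply/aut_invE; rewrite gk.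
case: b.
  exists (f * g^-1); split=> [|k ki|]; last by apply: subgroup_genM => //; apply: subgroup_genV.
    by rewrite autME g'i !autM fi autV fj letter_genV reversalM reversalV reversal_gen !mulgA.
  by rewrite autME g'k // fk.
exists (f * g); split=> [|k ki|]; last by apply: subgroup_genM.
  by rewrite autME gi !autM fi fj reversalM reversal_gen !mulgA.
by rewrite autME gk // fk.
Qed.

Lemma generated_centraliser : (generated `<=` centraliser (raag_iota e))%classic.
Proof.
apply: subgroup_gen_centraliser => f fG; apply/aut_gen_ext => v.
rewrite !autME raag_iota_gen autV.
have iotaV x : raag_iota e x^-1 = (raag_iota e x)^-1 := autV _ x.
case: fG => [[[[s [_ ->]]|[i [j [_ _ ij [fi fk]]]]]|[j [fj fk]]]|[i [j [_ _ [fi fk]]]]].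
- by rewrite raag_iota_gen.
- have [->|vi] := eqVneq v i; last by rewrite fk // raag_iota_gen.
  rewrite fi autM !raag_iota_gen -invgM; congr (_^-1).
  by move/eqP/commgP: ij => ->.
- have [->|vj] := eqVneq v j; last by rewrite fk // raag_iota_gen.
  by rewrite fj iotaV raag_iota_gen.
have [->|vi] := eqVneq v i; last by rewrite fk // raag_iota_gen.
by rewrite fi !autM !raag_iota_gen !invgM mulgA.
Qed.

End Generators.

(** * The action modulo 2 *)

Section ModTwo.
Variables (V : finType) (e : rel V).
Hypotheses (e_sym : symmetric e) (e_irr : irreflexive e).
Local Notation A := (raag e).
Local Notation parab := (@parab V e).
Local Notation letter := (@letter V e).
Local Notation gen := (gen e).
Local Notation st := (st e).
Local Notation C := (centraliser (raag_iota e)).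
Local Notation generated := (@generated V e).
Implicit Types (u v w i j k t : V) (a b : V * bool) (g h x y : A) (f d : aut A).
Implicit Types (X Y T D : {set V}).

(** Vectors over the field with two elements are represented by the set of
    their non-zero coordinates. *)
Definition odd_supp g : {set V} := [set u | par [set u] g].

Lemma in_odd_supp u g : (u \in odd_supp g) = par [set u] g.
Proof. by rewrite inE. Qed.

Lemma odd_supp_gen v : odd_supp (gen v) = [set v].
Proof. by apply/setP => u; rewrite !inE par_gen inE eq_sym. Qed.

Definition column f v : {set V} := odd_supp (f (gen v)).

Lemma par_aut f u g :
  par [set u] (f g) = \big[addb/false]_(v in odd_supp g) (u \in column f v).
Proof.
rewrite big_mkcond /=; under eq_bigr do rewrite !inE.
elim/raag_ind: g => [|a g IHg].
  by rewrite aut1 par1 big1 // => v _; rewrite par1.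
rewrite autM parM IHg; under [RHS]eq_bigr => v _ do rewrite parM par_letter inE.
have -> : par [set u] (f (letter a)) =
    \big[addb/false]_v (if a.1 == v then par [set u] (f (gen v)) else false).
  rewrite (bigD1 a.1) //= eqxx big1 ?addbF; last by move=> v /negPf; rewrite eq_sym => ->.
  by rewrite aut_letter; case: a.2; rewrite ?parV.
rewrite -big_split /=; apply: eq_bigr => v _.
by case: (a.1 == v); case: (par [set v] g); rewrite ?addbF ?addFb ?addbb.
Qed.

Definition mod2 f X : {set V} :=
  [set u | \big[addb/false]_(v in X) (u \in column f v)].

Lemma odd_supp_aut f g : odd_supp (f g) = mod2 f (odd_supp g).
Proof. by apply/setP => u; rewrite !inE par_aut. Qed.

Lemma odd_supp_onto X : exists g, odd_supp g = X.
Proof.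
exists (\prod_(v <- enum X) gen v); apply/setP => u; rewrite inE.
rewrite (big_morph _ (parM [set u]) (par1 e [set u])) /=.
under eq_bigr do rewrite par_gen inE.
rewrite big_enum /= big_mkcond /= (bigD1 u) //= eqxx big1 ?addbF.
  by case: (u \in X).
by move=> v /negPf->; case: ifP.
Qed.

Lemma mod2_inj f : injective (mod2 f).
Proof.
move=> X Y; have [[g <-] [h <-]] := (odd_supp_onto X, odd_supp_onto Y).
rewrite -!odd_supp_aut => /(congr1 (mod2 f^-1)).
by rewrite -!odd_supp_aut -!autME mulVg.
Qed.

Lemma mod2_sub f X T : (forall v, v \in X -> column f v \subset T) ->
  mod2 f X \subset T.
Proof.
move=> XT; apply/subsetP => u; rewrite inE; apply: contraTT => uT.
rewrite big1 // => v /XT/subsetP/(_ u) vT.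
by apply/negbTE; apply: contra uT.
Qed.

Lemma column_clique f v u w : C f -> u \in column f v -> w \in column f v ->
  u != w -> e u w.
Proof.
move=> fC; rewrite !in_odd_supp => uv wv uw; apply: contraT => /(par_palindrome e_sym uw).
move=> /(_ (f (gen v))); rewrite -centraliser_rev // reversal_gen uv wv.
by move=> /(_ erefl).
Qed.

Lemma in_st u v : (u \in st v) = (u == v) || e v u.
Proof. by rewrite !inE. Qed.

(** Since [f v] and [f w] commute when [w] is in the star of [v], and the odd
    support of [f v] is a clique. *)
Lemma column_st f v w u : C f -> w \in st v -> u \in column f v ->
  column f w \subset st u.
Proof.
move=> fC wv uv; apply/subsetP => t tw; apply: contraT; rewrite in_st negb_or.
case/andP=> tu eut; have vw : commute (f (gen v)) (f (gen w)).
  rewrite /commute -!autM; congr (f _).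
  by move: wv; rewrite in_st => /orP[/eqP->|/gen_commute].
have ut : u != t by rewrite eq_sym.
have := par_commute e_sym ut eut vw; rewrite -!in_odd_supp -/(column f v) -/(column f w) uv tw.
have [tv _|_] := boolP (t \in column f v); last by rewrite andbF.
by move: eut; rewrite (column_clique fC uv tv ut).
Qed.

(** So [mod2 f] embeds the span of the star of [v] in the span of the star of
    [u]. *)
Lemma mod2_powerset f v u : C f -> u \in column f v ->
  mod2 f @: powerset (st v) \subset powerset (st u).
Proof.
move=> fC uv; apply/subsetP => _ /imsetP[X + ->]; rewrite !powersetE => /subsetP XT.
by apply: mod2_sub => w /XT wv; apply: column_st uv.
Qed.

Lemma column_card_st f v u : C f -> u \in column f v -> #|st v| <= #|st u|.
Proof.
move=> fC uv; have := subset_leq_card (mod2_powerset fC uv).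
by rewrite card_imset ?card_powerset ?leq_exp2l //; apply: mod2_inj.
Qed.

(** Some term of the Leibniz expansion of the determinant is non-zero. *)
Lemma column_transversal f : exists s : {perm V}, forall v, s v \in column f v.
Proof.
pose n := #|V|; pose M d : 'M['F_2]_n :=
  (\matrix_(i, j) (enum_val j \in column d (enum_val i))%:R)%R.
have bigF2 (P : pred V) F : ((\big[addb/false]_(v | P v) F v)%:R =
    \sum_(v | P v) (F v)%:R :> 'F_2)%R.
  by apply: (big_morph (fun b : bool => (b%:R : 'F_2)%R)) => // -[] []; apply/val_inj.
have M1 : (M f *m M f^-1%g = 1%:M)%R.
  apply/matrixP => i k; rewrite !mxE.
  under eq_bigr do rewrite !mxE -GRing.natrM mulnb.
  have -> : ((i == k)%:R = (enum_val k \in mod2 f^-1%g (column f (enum_val i)))%:R :> 'F_2)%R.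
    rewrite -odd_supp_aut -autME mulVg odd_supp_gen inE (inj_eq enum_val_inj).
    by rewrite eq_sym.
  rewrite inE bigF2 [RHS]big_mkcond /=.
  rewrite [RHS](_ : _ = \sum_(v in V) (if v \in column f (enum_val i) then
    (enum_val k \in column f^-1%g v)%:R else 0))%R; last by apply: eq_bigl.
  rewrite [RHS]big_enum_val; apply: eq_bigr => j _.
  by case: (_ \in column f _).
have : (\det (M f) != 0)%R.
  apply/eqP => M0; have := congr1 determinant M1.
  by rewrite det_mulmx M0 GRing.mul0r det1 => /eqP; rewrite eq_sym GRing.oner_eq0.
rewrite /determinant => /eqP detM.
have [s sM] : exists s : 'S_n, forall i : 'I_n, M f i (s i) != 0%R.
  apply/not_existsP => noS; apply: detM; apply: big1 => s _.
  have /existsNP[i /negP] := noS s; rewrite negbK => /eqP Mi.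
  by rewrite (bigD1 i) //= Mi GRing.mul0r GRing.mulr0.
have inj : injective (fun v => enum_val (s (enum_rank v))).
  by move=> u v /enum_val_inj/perm_inj/enum_rank_inj.
exists (perm inj) => v; rewrite permE; have := sM (enum_rank v).
by rewrite mxE enum_rankK; case: (_ \in _).
Qed.

Section Transversal.
Variables (f : aut A) (s : {perm V}).
Hypotheses (fC : C f) (sf : forall v, s v \in column f v).

Lemma transversal_card_st v : #|st (s v)| = #|st v|.
Proof.
have le w : #|st w| <= #|st (s w)| by apply: column_card_st fC (sf w).
have E : \sum_w #|st (s w)| = \sum_w #|st w|.
  by rewrite (reindex_inj (@perm_inj _ s^-1)); apply: eq_bigr => w _; rewrite permKV.
have := leqif_sum (fun w (_ : true) => leqif_eq (le w)).
by move=> [_]; rewrite E eqxx => /esym/forall_inP/(_ v isT)/eqP->.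
Qed.

(** For [u = s v] the embedding of spans is onto, for reasons of cardinality. *)
Lemma transversal_st v u : u \in column f v -> st (s v) \subset st u.
Proof.
move=> uv; have := mod2_powerset fC uv.
suff -> : mod2 f @: powerset (st v) = powerset (st (s v)).
  by move=> /subsetP/(_ (st (s v))); rewrite !powersetE subxx; apply.
apply/eqP; rewrite eqEcard mod2_powerset //=.
by rewrite (card_imset _ (@mod2_inj f)) !card_powerset transversal_card_st.
Qed.

Lemma transversal_edge : {mono s : u v / e u v}.
Proof.
have homo u v : e u v -> e (s u) (s v).
  move=> uv; have : s v \in st (s u).
    by apply: (subsetP (column_st fC _ (sf u)) _ (sf v)); rewrite in_st uv orbT.
  rewrite in_st (inj_eq perm_inj) => /orP[/eqP vu|//].
  by move: uv; rewrite vu e_irr.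
have E u : s @: st u = st (s u).
  apply/eqP; rewrite eqEcard card_imset ?transversal_card_st ?leqnn ?andbT; last exact: perm_inj.
  apply/subsetP => _ /imsetP[v + ->]; rewrite !in_st.
  by move=> /orP[/eqP->|/homo->]; rewrite ?eqxx ?orbT.
move=> u v; apply/idP/idP; last exact: homo.
move=> uv; have : s v \in st (s u) by rewrite in_st uv orbT.
rewrite -E (mem_imset _ _ perm_inj) in_st => /orP[/eqP vu|//].
by move: uv; rewrite vu e_irr.
Qed.

End Transversal.

Lemma centraliserM f d : C f -> C d -> C (f * d).
Proof. exact: commuteM. Qed.

Lemma generatedMl d f : generated d -> generated (d * f) -> generated f.
Proof.
move=> dG dfG; rewrite -(mulKg d f); apply: subgroup_genM => //.
exact: subgroup_genV.
Qed.

Lemma par_transvection i j d u g : is_transvection i j d ->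
  par [set u] (d g) = par [set u] g (+) (par [set i] g && (u == j)).
Proof.
case=> di dk; elim/raag_ind: g => [|a g IHg]; first by rewrite aut1 !par1.
have -> : par [set u] (d (letter a * g)) =
    par [set u] (letter a) (+) (par [set i] (letter a) && (u == j)) (+) par [set u] (d g).
  rewrite autM parM; congr addb; rewrite aut_letter !par_letter !inE.
  have -> : par [set u] (if a.2 then (d (gen a.1))^-1 else d (gen a.1)) = par [set u] (d (gen a.1)).
    by case: a.2; rewrite ?parV.
  have [->|ai] := eqVneq a.1 i; first by rewrite di parM !par_gen !inE (eq_sym j).
  by rewrite dk // par_gen inE addbF.
rewrite IHg !parM; move: (par _ (letter a)) (par _ (letter a)) (par _ g) (par _ g) (u == j).
by move=> [] [] [] [] [].
Qed.

(** Transvections of [v] applied after [f] clear the column of [v] and spare the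
    columns of [D], in which [v] does not occur. *)
Lemma clear_column n f v D : v \notin D -> #|column f v| <= n -> C f ->
  v \in column f v -> (forall u, u \in column f v -> u != v -> e v u && dominated e v u) ->
  (forall w, w \in D -> column f w = [set w]) ->
  (forall d, C d -> (forall w, w \in v |: D -> column d w = [set w]) -> generated d) ->
  generated f.
Proof.
elim: n f => [|n IHn] f vD fn fC vf fv fD IH.
  by move: fn; rewrite leqn0 cards_eq0 => /eqP f0; rewrite f0 inE in vf.
have [fv1|[u uf]] := set_0Vmem (column f v :\ v).
  apply: IH => // w /setU1P[->|/fD//]; apply/setP => u; rewrite inE.
  have [->//|uv] := eqVneq u v; apply: contraFF (in_set0 u) => uf.
  by rewrite -fv1 in_setD1 uv.
move: uf; rewrite in_setD1 => /andP[uv uf].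
have /andP[euv domuv] := fv u uf uv.
have [d [dP dG]] := adjacent_transvection e_sym e_irr euv domuv.
have cE w : column (d * f) w = if v \in column f w then
    [set t | (t \in column f w) (+) (t == u)] else column f w.
  apply/setP => t; rewrite in_odd_supp autME (par_transvection _ _ dP) -!in_odd_supp -/(column f w).
  by case: ifP => _; rewrite ?inE ?andTb ?andFb ?addbF.
have cv : column (d * f) v = column f v :\ u.
  rewrite cE vf; apply/setP => t; rewrite !inE.
  by case: eqP => [->|_]; rewrite ?addbF -?in_odd_supp ?uf.
apply: (generatedMl dG); apply: (IHn _ vD) => //.
- by rewrite cv -ltnS; apply: leq_trans fn; rewrite (cardsD1 u (column f v)) uf.
- exact/centraliserM/fC/generated_centraliser.
- by rewrite cv !inE eq_sym uv -in_odd_supp.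
- by move=> w; rewrite cv in_setD1 => /andP[_]; apply: fv.
- move=> w wD; rewrite cE fD // inE; case: eqP => // vw.
  by rewrite vw wD in vD.
Qed.

(** Gaussian elimination: once a transversal has been moved to the diagonal by a
    diagram automorphism, every entry in the column of [v] lies in a row that
    dominates [v] and is adjacent to it, and an adjacent transvection clears it. *)
Lemma pure_reduction : (forall f, pure f -> generated f) -> forall f, C f -> generated f.
Proof.
move=> pureG f; have [n] := ubnP #|[set v | column f v != [set v]]|.
elim: n f => // n IHn f; rewrite ltnS => fn fC.
have [s sf] := column_transversal f.
have sM := transversal_edge fC sf.
have s'M : {mono s^-1%g : u v / e u v} by move=> u v; rewrite -sM !permKV.
have [d dE] := diagram_exists s'M.
have dG := diagram_gen s'M dE; apply: (generatedMl dG).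
have dfC : C (d * f) by apply/centraliserM/fC/generated_centraliser.
have cE v : column (d * f) v = s @^-1: column f v.
  apply/setP => u; rewrite in_odd_supp autME par_aut inE -/(column f v).
  rewrite big_mkcond /= (bigD1 (s u)) //= /column dE permK odd_supp_gen set11.
  rewrite big1 ?addbF; first by case: (_ \in _).
  move=> w ws; case: ifP => // _; rewrite dE odd_supp_gen inE.
  by apply: contraNF ws => /eqP->; rewrite permKV.
have vdf v : v \in column (d * f) v by rewrite cE inE.
have domdf v u : u \in column (d * f) v -> u != v -> e v u && dominated e v u.
  move=> uv vu; rewrite (column_clique dfC _ uv) ?vdf 1?eq_sym //=.
  have := transversal_st fC sf (u := s u) (v := v); rewrite cE inE in uv => /(_ uv).
  move=> /subsetP sub; apply/subsetP => w; rewrite inE -sM => vw.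
  have := sub (s w); rewrite !in_st vw orbT => /(_ isT).
  by rewrite sM (inj_eq perm_inj).
have fixdf v : column f v = [set v] -> column (d * f) v = [set v].
  move=> fv; have := sf v; rewrite fv inE => /eqP sv; rewrite cE fv -{1}sv.
  by apply/setP => u; rewrite !inE (inj_eq perm_inj).
have [allv|[v vdf']] := set_0Vmem [set v | column (d * f) v != [set v]].
  apply: pureG; split=> // S g; rewrite par_sum [RHS]par_sum; apply: eq_bigr => u _.
  rewrite par_aut big_mkcond /= (bigD1 u) //= big1 ?addbF.
    rewrite in_odd_supp; have -> : column (d * f) u = [set u].
      by apply/eqP; have := in_set0 u; rewrite -allv inE => /negbFE.
    by rewrite set11; case: par.
  move=> w wu; case: ifP => // _; have -> : column (d * f) w = [set w].
    by apply/eqP; have := in_set0 w; rewrite -allv inE => /negbFE.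
  by rewrite inE eq_sym (negPf wu).
rewrite inE in vdf'.
apply: (@clear_column _ (d * f) v [set w | column (d * f) w == [set w]] _ (leqnn _)) => //.
- by rewrite inE.
- by move=> u; apply: domdf.
- by move=> w; rewrite inE => /eqP.
move=> d' d'C d'D; apply: IHn => //; apply: leq_trans fn; apply: proper_card.
apply/properP; split.
  apply/subsetP => w; rewrite !inE; apply: contra => /eqP/fixdf fw.
  by apply/eqP/d'D; rewrite !inE fw eqxx orbT.
exists v; first by rewrite inE; apply: contra vdf' => /eqP/fixdf ->.
by rewrite inE d'D ?eqxx // setU11.
Qed.

End ModTwo.

(** * Pure automorphisms *)

Section Pure.
Variables (V : finType) (e : rel V).
Hypotheses (e_sym : symmetric e) (e_irr : irreflexive e).
Local Notation A := (raag e).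
Local Notation parab := (@parab V e).
Local Notation letter := (@letter V e).
Local Notation gen := (gen e).
Local Notation reversal := (@reversal V e).
Local Notation C := (centraliser (raag_iota e)).
Local Notation generated := (@generated V e).
Local Notation pure := (@pure V e).
Local Notation up := (up e).
Implicit Types (u v w i j k t : V) (a b : V * bool) (g h x y : A) (f d : aut A).
Implicit Types (S T U D : {set V}).

Lemma dominated_refl v : dominated e v v.
Proof. by apply/subsetP => w vw; rewrite !inE in vw *; rewrite vw orbT. Qed.

Lemma dominated_trans u v w : dominated e u v -> dominated e v w -> dominated e u w.
Proof.
move=> /subsetP uv /subsetP vw; apply/subsetP => x; rewrite inE => ux.
have := uv x; rewrite !inE => /(_ ux)/orP[/eqP xv|vx]; last first.
  by have := vw x; rewrite !inE; apply.
have := vw u; rewrite !inE -xv e_sym => /(_ ux)/orP[/eqP uw|wu].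
  by rewrite -uw ux orbT.
have := uv w; rewrite !inE e_sym => /(_ wu).
by rewrite -xv e_sym (eq_sym x).
Qed.

Lemma up_sub u v : dominated e v u -> up u \subset up v.
Proof. by move=> vu; apply/subsetP => w; rewrite !inE; apply: dominated_trans. Qed.

Lemma up_refl v : v \in up v.
Proof. by rewrite inE dominated_refl. Qed.

Lemma pureP f : C f -> (forall S v, par S (f (gen v)) = par S (gen v)) -> pure f.
Proof.
move=> fC fP; split=> // S g; elim/raag_ind: g => [|a g IHg]; first by rewrite aut1.
rewrite autM !parM IHg aut_letter; congr addb.
by case: a => v []; rewrite ?parV fP // letter_genV parV.
Qed.

Lemma pureM f d : pure f -> pure d -> pure (f * d).
Proof.
move=> [fC fP] [dC dP]; split; first exact: centraliserM.
by move=> S g; rewrite autME fP dP.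
Qed.

Lemma pureV f : pure f -> pure f^-1.
Proof.
move=> [fC fP]; split; first exact: commuteV.
by move=> S g; rewrite -{2}[g]aut1E -(mulgV f) autME fP.
Qed.

Lemma generatedMr d f : generated d -> generated (f * d) -> generated f.
Proof.
move=> dG fdG; rewrite -(mulgK d f); apply: subgroup_genM => //.
exact: subgroup_genV.
Qed.

(** Palindromic moves keep an automorphism pure, because the two copies of [h]
    cancel modulo 2. *)
Lemma sandwich_pure i h : h \in parab (up i :\ i) -> exists f,
  [/\ f (gen i) = h * gen i * reversal h, forall k, k != i -> f (gen k) = gen k,
      generated f & pure f].
Proof.
move=> /(sandwich_gen e_sym)[f [fi fk fG]]; exists f; split=> //.
apply: pureP => [|S v]; first exact: generated_centraliser.
have [->|vi] := eqVneq v i; last by rewrite fk.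
by rewrite fi !parM par_rev addbAC addbb.
Qed.

Lemma inversion_pure j : exists f, [/\ is_inversion j f, generated f & pure f].
Proof.
have [f fP] := inversion_exists e j; have fG := inversion_gen fP.
exists f; split=> //; case: fP => fj fk.
apply: pureP => [|S v]; first exact: generated_centraliser.
by have [->|vj] := eqVneq v j; rewrite ?fj ?parV // fk.
Qed.

End Pure.

(** * Cliques *)

Section Exponents.
Import GRing.Theory Num.Theory.
Variables (V : finType) (e : rel V).
Hypotheses (e_sym : symmetric e) (e_irr : irreflexive e).
Local Notation A := (raag e).
Local Notation parab := (@parab V e).
Local Notation letter := (@letter V e).
Local Notation gen := (gen e).
Local Notation reversal := (@reversal V e).
Implicit Types (u v w i j k t : V) (a b : V * bool) (g h x y : A) (f d : aut A).
Implicit Types (S T U D : {set V}).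

Definition sgl (u : V) (a : V * bool) : int :=
  if a.1 == u then (if a.2 then -1 else 1)%R else 0%R.

Definition zexp u g : int := (\sum_(a <- repr g) sgl u a)%R.

Lemma zexp_class u (w : word V) : zexp u (raag_class e w) = (\sum_(a <- w) sgl u a)%R.
Proof.
suff E (w1 w2 : word V) : word_eqv e w1 w2 ->
    (\sum_(a <- w1) sgl u a = \sum_(a <- w2) sgl u a)%R.
  exact/E/repr_raag_class.
elim=> {w w1 w2} // [w1 w2 w3 _ -> _ ->|w1 w2 w3 w4 _ E1 _ E2|a|v v' _] //=.
- by rewrite !big_cat /= E1 E2.
- rewrite !big_cons !big_nil /sgl /=.
  by case: a => v [] /=; case: ifP; rewrite ?addr0 ?addNr ?addrN.
- by rewrite !big_cons !big_nil !addr0 addrC.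
Qed.

Lemma zexpM u g h : zexp u (g * h) = (zexp u g + zexp u h)%R.
Proof.
rewrite -{1}(raag_reprK g) -{1}(raag_reprK h).
by rewrite -(raag_classM e (repr g)) zexp_class big_cat.
Qed.

Lemma zexp1 u : zexp u 1 = 0%R.
Proof. by rewrite (zexp_class u [::]) big_nil. Qed.

Lemma zexpV u g : zexp u g^-1 = (- zexp u g)%R.
Proof. by apply/eqP; rewrite -addr_eq0 -zexpM mulVg zexp1. Qed.

Lemma zexp_letter u a : zexp u (letter a) = sgl u a.
Proof. by rewrite zexp_class big_seq1. Qed.

Lemma zexp_gen u v : zexp u (gen v) = (if v == u then 1 else 0)%R.
Proof. exact: (zexp_letter u (v, false)). Qed.

Lemma zexp_rev u g : zexp u (reversal g) = zexp u g.
Proof.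
elim/raag_ind: g => [|a g IHg]; first by rewrite reversal1.
by rewrite reversalM !zexpM IHg reversal_letter addrC.
Qed.

Lemma zexp_parab u S g : u \notin S -> g \in parab S -> zexp u g = 0%R.
Proof.
move=> uS; elim/parab_ind => [|a h aS _ IH]; first exact: zexp1.
rewrite zexpM IH zexp_letter /sgl addr0; case: eqP => // au.
by rewrite -au aS in uS.
Qed.

Lemma odd_zexp u g : odd `|zexp u g|%N = par [set u] g.
Proof.
have oddD (m n : int) : odd `|(m + n)%R|%N = odd `|m|%N (+) odd `|n|%N by lia.
elim/raag_ind: g => [|a g IHg]; first by rewrite zexp1 par1.
rewrite zexpM oddD IHg parM zexp_letter par_letter inE /sgl.
by case: ifP => // _; case: a.2.
Qed.

Definition zpow g (n : int) : A :=
  match n with Posz m => g ^+ m | Negz m => (g ^+ m.+1)^-1 end.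

Lemma zpowS g (n : int) : zpow g (n + 1)%R = g * zpow g n.
Proof.
case: n => [m|[|m]].
- by rewrite (_ : (Posz m + 1)%R = Posz m.+1) /= ?expgS //; lia.
- by rewrite /= mulgV.
rewrite (_ : (Negz m.+1 + 1)%R = Negz m); last by lia.
by rewrite /= (expgSr _ m.+1) invgM mulVKg. 
Qed.

Lemma zpow_parab S g n : g \in parab S -> zpow g n \in parab S.
Proof.
move=> gS; have X m : g ^+ m \in parab S.
  by elim: m => [|m IHm]; rewrite ?parab1 // expgS parabM.
by case: n => m /=; rewrite ?parabV.
Qed.

Lemma zexp_zpow u g n : zexp u (zpow g n) = (zexp u g * n)%R.
Proof.
have X m : zexp u (g ^+ m) = (zexp u g * Posz m)%R.
  elim: m => [|m IHm]; first by rewrite zexp1 mulr0.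
  by rewrite expgS zexpM IHm -addn1 PoszD mulrDr mulr1 addrC.
by case: n => m /=; rewrite ?zexpV X // NegzE mulrN.
Qed.

Definition clique S := {in S &, forall u v, u != v -> e u v}.

Section Clique.
Variable S : {set V}.
Hypothesis S_clique : clique S.

Lemma clique_commute g h : g \in parab S -> h \in parab S -> commute g h.
Proof.
have gc u v : u \in S -> v \in S -> commute (gen u) (gen v).
  by move=> uS vS; have [->//|uv] := eqVneq u v; apply/gen_commute/S_clique.
move=> gS; apply: commute_parab => v vS; apply/commute_sym.
by apply: commute_parab gS => u uS; apply: gc.
Qed.

Lemma clique_rev g : g \in parab S -> reversal g = g.
Proof.
elim/parab_ind => [|a h aS hS IH]; first exact: reversal1.
by rewrite reversalM IH reversal_letter; apply: clique_commute => //; apply: parab_letter.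
Qed.

Lemma clique_split u g : u \in S -> g \in parab S ->
  exists2 r, r \in parab (S :\ u) & g = zpow (gen u) (zexp u g) * r.
Proof.
move=> uS; elim/parab_ind => [|[v b] h /= vS hS [r rS Eh]].
  by exists 1; rewrite ?parab1 // zexp1 mulg1.
have SuS := subsetP (subsetDl S [set u]).
have [vu|vu] := eqVneq v u.
  exists r => //; rewrite zexpM zexp_letter /sgl /= vu eqxx {1}Eh mulgA; congr (_ * _).
  case: b; rewrite ?letter_genV ?letter_gen ?vu; last by rewrite [in RHS]addrC zpowS.
  by apply: (@mulgI _ (gen u)); rewrite mulVKg -zpowS; congr zpow; rewrite addrAC subrr add0r.
exists (letter (v, b) * r); first by rewrite parabM // parab_letter // !inE vu.
rewrite zexpM zexp_letter /sgl /= (negPf vu) add0r {1}Eh !mulgA; congr (_ * _).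
by apply: clique_commute; [apply: parab_letter | apply/zpow_parab/parab_gen].
Qed.

Lemma subset_setC1 T u : u \notin T -> T \subset [set~ u].
Proof. by move=> uT; apply/subsetP => v vT; rewrite !inE; apply: contraNneq uT => <-. Qed.

Lemma clique_zexp0 T g : g \in parab S -> (forall t, t \in T -> zexp t g = 0%R) ->
  g \in parab (S :\: T).
Proof.
move=> gS gT; apply: parab_support => u; rewrite !inE negb_and negbK => /orP[uT|uS].
  have [uS|uS] := boolP (u \in S); last by apply: parabS gS; apply: subset_setC1.
  have [r rS ->] := clique_split uS gS; rewrite gT // mul1g.
  by apply: parabS rS; rewrite setDE subsetIr.
by apply: parabS gS; apply: subset_setC1.
Qed.

End Clique.

Lemma zpow_double g (n : int) : zpow g (n * 2)%R = zpow g n * zpow g n.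
Proof.
case: n => m; first by rewrite -PoszM /= muln2 -addnn expgnDr.
rewrite (_ : (Negz m * 2)%R = Negz (m.+1 + m)); last by lia.
by rewrite /= -addnS expgnDr invgM.
Qed.

(** In a free abelian group an element with even exponents is a square. *)
Lemma clique_sqr S g : clique S -> g \in parab S ->
  (forall u, u \in S -> par [set u] g = false) ->
  exists2 h, h \in parab S & g = h * h.
Proof.
have [n] := ubnP #|S|; elim: n S g => // n IHn S g; rewrite ltnS => Sn Scl gS gpar.
have [S0|[u uS]] := set_0Vmem S.
  exists 1; rewrite ?parab1 // mulg1; move: gS; rewrite S0.
  by elim/parab_ind => // a h; rewrite inE.
have [r rS Eg] := clique_split Scl uS gS.
have SuS : S :\ u \subset S by apply: subsetDl.
have zpar v m : u != v -> par [set v] (zpow (gen u) m) = false.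
  move=> uv; apply: (@par_parab _ _ _ [set u]); last by rewrite zpow_parab ?parab_gen ?set11.
  by rewrite disjoints1 inE eq_sym.
have [||v vS|h hS Er] := IHn (S :\ u) r _ _ rS.
- by apply: leq_trans Sn; rewrite (cardsD1 u S) uS.
- by move=> v w /(subsetP SuS) vS /(subsetP SuS) wS; apply: Scl.
- move: vS (gpar v); rewrite in_setD1 => /andP[vu vS]; rewrite Eg parM zpar 1?eq_sym //.
  by apply.
have [m Em] : exists m : int, zexp u g = (m * 2)%R.
  exists (zexp u g %/ 2)%Z; have := gpar u uS; rewrite -odd_zexp.
  by lia.
exists (zpow (gen u) m * h); first by rewrite parabM ?(parabS SuS hS) ?zpow_parab ?parab_gen.
rewrite Eg Em zpow_double Er !mulgA; congr (_ * _); rewrite -!mulgA; congr (_ * _).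
by apply: (clique_commute Scl); rewrite ?(parabS SuS hS) ?zpow_parab ?parab_gen.
Qed.

End Exponents.

(** * Elimination for a class that spans a clique *)

Section CliqueClass.
Import GRing.Theory Num.Theory.
Variables (V : finType) (e : rel V).
Hypotheses (e_sym : symmetric e) (e_irr : irreflexive e).
Local Notation A := (raag e).
Local Notation parab := (@parab V e).
Local Notation letter := (@letter V e).
Local Notation gen := (gen e).
Local Notation reversal := (@reversal V e).
Local Notation generated := (@generated V e).
Local Notation pure := (@pure V e).
Local Notation up := (up e).
Implicit Types (u v w i j k t : V) (a b : V * bool) (g h x y : A) (f d : aut A).
Implicit Types (S T D : {set V}).

Definition fixes f S := forall u, u \in S -> f (gen u) = gen u.

Lemma fixesV f S : fixes f S -> fixes f^-1 S.
Proof. by move=> fS u uS; apply/aut_invE; rewrite fS. Qed.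

Lemma zexp_sandwich d i h u g : d (gen i) = h * gen i * reversal h ->
  (forall k, k != i -> d (gen k) = gen k) ->
  zexp u (d g) = (zexp u g + zexp i g * (zexp u h * 2))%R.
Proof.
move=> di dk; elim/raag_ind: g => [|[v b] g IHg].
  by rewrite aut1 !zexp1 mul0r addr0.
rewrite autM !zexpM IHg mulrDl addrACA; congr (_ + _)%R.
have -> : zexp i (letter (v, b)) = (if v == i then (if b then -1 else 1) else 0)%R.
  exact: zexp_letter.
rewrite aut_letter /=; have [->|vi] := eqVneq v i; last first.
  by rewrite dk // mul0r addr0; case: b; rewrite -?letter_genV.
by case: b; rewrite ?letter_genV ?zexpV di !zexpM zexp_rev ?letter_gen; lia.
Qed.

Lemma aut_zpow f g n : f (zpow g n) = zpow (f g) n.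
Proof.
have X m : f (g ^+ m) = f g ^+ m.
  by elim: m => [|m IHm]; rewrite ?aut1 // !expgS autM IHm.
by case: n => m /=; rewrite ?autV X.
Qed.

Variables (U K W : {set V}).
Hypotheses (KU : [disjoint K & U]) (WUK : W \subset U :|: K) (KW : K \subset W).
Hypotheses (W_clique : clique e W) (up_K : {in K, forall k, up k = W}).

(** A Euclidean algorithm with even steps: [f k] has an odd exponent at [k] and
    even exponents elsewhere, so two non-zero exponents, one of them at [k],
    have different absolute values and the larger one can be reduced by twice
    the smaller. *)
Lemma clique_class_vertex f k D : D \subset K -> k \in K -> k \notin D ->
  pure f -> fixes f (U :|: D) ->
  (forall d, pure d -> fixes d (k |: (U :|: D)) -> generated d) -> generated f.
Proof.
move=> DK kK kD fP fUD IH.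
pose T := K :\: D; have kT : k \in T by rewrite inE kD.
have TK t : t \in T -> t \in K by rewrite inE => /andP[].
have notT t w : t \in T -> w \in U :|: D -> w != t.
  rewrite !inE => /andP[tD tK] /orP[wU|wD].
    by apply: contraTneq wU => ->; rewrite (disjointFr KU tK).
  by apply: contraNneq tD => <-.
pose N f := \sum_(t in T) `|zexp t (f (gen k))|%N.
have [n] := ubnP (N f); elim: n f fP fUD => // n IHn f fP fUD; rewrite ltnS => Nn.
set x := f (gen k) in Nn *.
have par_x t : odd `|zexp t x|%N = (k == t) by rewrite odd_zexp fP.2 par_gen inE.
have reduce i j : i \in T -> j \in T -> i != j ->
    0 < `|zexp i x|%N < `|zexp j x|%N -> generated f.
  move=> iT jT ij lij.
  have [b bE] : exists b : bool,
      (`|zexp j x + zexp i x * ((if b then -1 else 1) * 2)|%R < `|zexp j x|%N%:R)%R.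
    have [s|s] := boolP ((0 <= zexp j x) == (0 <= zexp i x))%R; [exists true|exists false]; lia.
  have hP : letter (j, b) \in parab (up i :\ i).
    by rewrite parab_letter // up_K ?TK // !inE eq_sym ij (subsetP KW) ?TK.
  have [d [di dk dG dP]] := sandwich_pure e_sym hP.
  apply: (generatedMl dG); apply: IHn; first exact: pureM.
    by move=> w wUD; rewrite autME fUD // dk // notT.
  apply: leq_trans Nn; rewrite /N (bigD1 j) //= [leqRHS](bigD1 j) //= -addSn.
  rewrite leq_add //; last first.
    apply: leq_sum => t /andP[tT tj]; rewrite (zexp_sandwich _ _ di dk) zexp_letter /sgl /=.
    by rewrite eq_sym (negPf tj) mul0r mulr0 addr0.
  rewrite (zexp_sandwich _ _ di dk) zexp_letter /sgl /= eqxx -/x; clear -bE lij.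
  by case: b bE => /=; move: (zexp j x) (zexp i x) lij => m p lij bE; lia.
have [[t [tT tk tx]]|noT] := pselect (exists t, [/\ t \in T, t != k & zexp t x != 0%R]).
  have := par_x t; have := par_x k; rewrite eqxx eq_sym (negPf tk) => ox et.
  have [l|l|E] := ltngtP `|zexp t x|%N `|zexp k x|%N; last by rewrite E ox in et.
    by apply: (reduce t k) => //; rewrite l absz_gt0 tx.
  by apply: (reduce k t); rewrite 1?eq_sym // l andbT lt0n; apply: contraTneq ox => ->.
have {}noT t : t \in T -> t != k -> zexp t x = 0%R.
  move=> tT tk; by apply/eqP/negPn/negP => tx; apply: noT; exists t.
have kW := subsetP KW k kK.
have xW : x \in parab W by rewrite -(up_K kK); apply: pure_support.
have [r rW Ex] := clique_split W_clique kW xW.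
have rUD : r \in parab (U :|: D).
  have cl : clique e (W :\ k).
    by move=> u v; rewrite !inE => /andP[_ uW] /andP[_ vW]; apply: W_clique.
  have rT t : t \in T :\ k -> zexp t r = 0%R.
    rewrite in_setD1 => /andP[tk tT]; have := noT t tT tk.
    by rewrite Ex zexpM zexp_zpow zexp_gen eq_sym (negPf tk) mul0r add0r.
  apply: parabS (clique_zexp0 cl rW rT); apply/subsetP => w.
  rewrite !inE !negb_and !negbK => /andP[wT /andP[wk wW]].
  have := subsetP WUK w wW; rewrite inE => /orP[->//|wK].
  by move: wT; rewrite (negPf wk) wK orbF /= => ->; rewrite orbT.
have kr : zexp k r = 0%R by apply: zexp_parab rW; rewrite !inE eqxx.
(* The inverse of [f] fixes [r] and maps [x] to [k], so the exponent is a unit. *)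
have m1 : `|zexp k x|%N = 1%N.
  have fV := fixesV fUD; have : zexp k (f^-1 x) = 1%R.
    by rewrite /x -autME mulVg zexp_gen eqxx.
  rewrite {1}Ex autM (aut_fix fV rUD) zexpM kr addr0 aut_zpow zexp_zpow.
  by move=> /(congr1 absz)/eqP; rewrite abszM muln_eq1 => /andP[_ /eqP].
have [d [dG dP dx dUD]] : exists d, [/\ generated d, pure d, d x = gen k * r & fixes d (U :|: D)].
  have dr d : (forall w, w != k -> d (gen w) = gen w) -> d r = r.
    move=> dk; apply: (aut_fix (S := W :\ k)) rW => w; rewrite in_setD1 => /andP[wk _].
    exact: dk.
  have [m|m] : zexp k x = 1%R \/ zexp k x = (-1)%R by lia.
    exists 1; split=> //; first exact: subgroup_gen1.
      by split=> //; apply: commute1.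
    by rewrite aut1E Ex m.
  have [d [[dk dk'] dG dP]] := inversion_pure e k.
  exists d; split=> //; last by move=> w wUD; apply: dk'; apply: notT wUD.
  by rewrite Ex m autM dr //= expg1 autV dk invgK.
(* What remains next to [k] is a square, absorbed by [k -> s^-1 k s^-1]. *)
have [s sW Er] : exists2 s, s \in parab (W :\ k) & r = s * s.
  apply: clique_sqr rW _ => [u v|u].
    by rewrite !inE => /andP[_ uW] /andP[_ vW]; apply: W_clique.
  rewrite in_setD1 => /andP[uk uW]; have := fP.2 [set u] (gen k); rewrite -/x Ex parM par_gen inE.
  rewrite eq_sym (negPf uk) (@par_parab _ _ _ [set k]) //; first by rewrite disjoints1 inE.
  by rewrite zpow_parab ?parab_gen ?set11.
have s'P : s^-1 \in parab (up k :\ k) by rewrite parabV up_K.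
have [d' [d'k d'w d'G d'P]] := sandwich_pure e_sym s'P.
apply: (generatedMl dG); apply: (generatedMl d'G); apply: IH; first by do 2!apply: pureM => //.
move=> w /setU1P[->|wUD]; last first.
  by rewrite !autME fUD // dUD // d'w // notT.
rewrite !autME -/x dx autM d'k.
have -> : d' r = r.
  apply: (aut_fix (S := W :\ k)) rW => w'; rewrite in_setD1 => /andP[wk _]; exact: d'w.
rewrite (clique_rev W_clique); last by rewrite parabV (parabS _ sW) // subsetDl.
rewrite Er !gnorm -mulgA.
have sC : commute (gen k) s.
  by apply: (clique_commute W_clique); rewrite ?parab_gen // (parabS _ sW) // subsetDl.
by rewrite sC mulKg.
Qed.

Lemma clique_class : (forall d, pure d -> fixes d (U :|: K) -> generated d) ->
  forall f, pure f -> fixes f U -> generated f.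
Proof.
move=> IH f fP fU.
suff main n D d : D \subset K -> #|K :\: D| <= n -> pure d -> fixes d (U :|: D) -> generated d.
  by apply: (main _ _ f (sub0set K) (leqnn _)); rewrite // setU0.
elim: n D d => [|n IHn] D d DK Dn dP dUD.
  apply: IH => //; suff <- : D = K by [].
  apply/eqP; rewrite eqEsubset DK -setD_eq0 -cards_eq0; by rewrite leqn0 in Dn.
have [KD|[k]] := set_0Vmem (K :\: D).
  by apply: IHn dUD; rewrite // KD cards0.
rewrite inE => /andP[kD kK]; apply: (clique_class_vertex DK kK kD dP dUD) => d' d'P d'D.
apply: (IHn (k |: D)) => //.
- by rewrite subUset sub1set kK.
- have -> : K :\: (k |: D) = (K :\: D) :\ k.
    by apply/setP => w; rewrite !inE negb_or andbA.
  by move: Dn; rewrite (cardsD1 k (K :\: D)) inE kD kK.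
- by move=> w; rewrite setUCA; apply: d'D.
Qed.

End CliqueClass.

(** * Elimination for an independent class *)

Section FreeClass.
Variables (V : finType) (e : rel V).
Hypotheses (e_sym : symmetric e) (e_irr : irreflexive e).
Local Notation A := (raag e).
Local Notation parab := (@parab V e).
Local Notation letter := (@letter V e).
Local Notation gen := (gen e).
Local Notation reversal := (@reversal V e).
Local Notation generated := (@generated V e).
Local Notation pure := (@pure V e).
Local Notation up := (up e).
Implicit Types (u v w i j k t : V) (a b : V * bool) (g h x y z : A) (f d : aut A).
Implicit Types (S T D : {set V}).

Variables (U K L W : {set V}).
Hypotheses (KL : common_link e K L) (KU : [disjoint K & U]).
Hypotheses (WUK : W \subset U :|: K) (KW : K \subset W).
Hypotheses (up_K : {in K, forall k, up k = W}).
Hypotheses (LW : {in L :&: W & W, forall u w, u != w -> e u w}).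

Local Notation len := (tlen K L).
Local Notation B := (parab (W :\: K)).

Let KL_disjoint : [disjoint K & L].
Proof.
apply/pred0P => k /=; apply/negbTE/negP => /andP[kK kL].
by case: KL => _ Ki Kl; move: kL; rewrite -(Kl k kK) inE e_irr.
Qed.

Let L_notK : L \subset ~: K.
Proof. by rewrite -disjoints_subset disjoint_sym. Qed.

Let LW_clique : clique e (L :&: W).
Proof. by move=> u v uLW; rewrite inE => /andP[_ vW]; apply: LW. Qed.

Let LW_commute y x : y \in parab L -> y \in parab W -> x \in parab W -> commute y x.
Proof.
move=> yL yW xW; have yLW : y \in parab (L :&: W) by rewrite parabI yL.
apply: commute_parab xW => w wW; apply/commute_sym; apply: commute_parab yLW => u uLW.
by have [->//|uw] := eqVneq u w; apply/commute_sym/gen_commute/LW.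
Qed.

Let B_W y : y \in B -> y \in parab W.
Proof. by apply: parabS; apply: subsetDl. Qed.

Let B_len y : y \in B -> len y = 0.
Proof. by move=> yB; apply: tlen_parab KL _ _; apply: parabS yB; rewrite setDE subsetIr. Qed.

Let len_B y : y \in parab W -> len y = 0 -> y \in B.
Proof. by move=> yW /(tlen0_parab KL) yK; rewrite setDE parabI yW. Qed.

Let B_up k y : k \in K -> y \in B -> y \in parab (up k :\ k).
Proof.
by move=> kK; apply: parabS; rewrite up_K //; apply: setDS; rewrite sub1set.
Qed.

Let K_up i b : i \in K -> b.1 \in K -> i != b.1 -> letter b \in parab (up i :\ i).
Proof.
by move=> iK bK ib; rewrite parab_letter // up_K // !inE eq_sym ib (subsetP KW).
Qed.

(** The image of a vertex of [K] is a palindrome around this vertex. *)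
Lemma half_exists f k : pure f -> k \in K -> exists h c,
  [/\ f (gen k) = h * letter (k, c) * reversal h, h \in parab W &
      len (f (gen k)) = (len h).*2.+1].
Proof.
move=> fP kK; set x := f (gen k).
have xW : x \in parab W by rewrite -(up_K kK); apply: pure_support.
have xP : reversal x = x by rewrite -(centraliser_rev fP.1) reversal_gen.
have xK : par K x by rewrite fP.2 par_gen.
have [h [a [q [Ex aK El hW [qW qL qP]]]]] := palindrome_middle KL KW xW xP xK.
have parE u : u \notin K :\ a.1 -> par [set u] q = (k == u) (+) (a.1 == u).
  move=> _; have := fP.2 [set u] (gen k); rewrite -/x Ex !parM par_rev par_letter par_gen !inE.
  by rewrite (addbC (par _ h)) addbAC -!addbA [par _ h (+) (_ (+) _)]addbA addbb => <-;
     case: (a.1 == u); case: (par _ q); case: (par _ h).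
have ak : a.1 = k.
  have := parE a.1; rewrite !inE eqxx (@par_parab _ _ _ L) ?disjoints1 //.
    by move=> /(_ isT); rewrite addbT => /esym/negbFE/eqP.
  by apply: contraTN aK => aL; rewrite (disjointFl KL_disjoint aL).
(* [q] has even exponents, so a square root of it goes to each side of [a]. *)
have [s sLW Eq] : exists2 s, s \in parab (L :&: W) & q = s * s.
  apply: clique_sqr LW_clique _ _; first by rewrite parabI qL.
  move=> u; rewrite inE => /andP[uL _]; rewrite parE ?ak ?addbb //.
  by rewrite !inE (disjointFl KL_disjoint uL) andbF.
have [sL sW] : s \in parab L /\ s \in parab W by move: sLW; rewrite parabI => /andP.
have s0 : len s = 0 by apply: tlen_parab KL _ _; apply: parabS L_notK sL.
exists (h * s), a.2; split.
- rewrite -ak -surjective_pairing Ex Eq reversalM (clique_rev LW_clique sLW) !mulgA.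
  by congr (_ * _ * _); rewrite -!mulgA (link_commute KL aK sL).
- by rewrite parabM.
- by rewrite El (tlenMr KL _ s0).
Qed.

Section Halves.
Variables (f : aut A) (H : V -> A) (c : V -> bool).
Hypotheses (fP : pure f) (fU : fixes f U).
Hypothesis HP : forall k, k \in K ->
  [/\ f (gen k) = H k * letter (k, c k) * reversal (H k), H k \in parab W &
      len (f (gen k)) = (len (H k)).*2.+1].

(** For every letter [a] over [K] the image [f a] is the palindrome with the first
    half [half a] and the middle letter [mid a]. *)
Definition half a := if a.2 then (reversal (H a.1))^-1 else H a.1.
Definition mid a : V * bool := (a.1, c a.1 (+) a.2).

Let half_inv a : half (letter_inv a) = (reversal (half a))^-1.
Proof. by case: a => k [] //=; rewrite /half /= reversalV reversalK invgK. Qed.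

Let mid_inv a : mid (letter_inv a) = letter_inv (mid a).
Proof. by case: a => k b; rewrite /mid /letter_inv /= addbN. Qed.

Let len_half a : len (half a) = len (H a.1).
Proof. by rewrite /half; case: a.2; rewrite ?(tlenV KL) ?(tlen_rev KL). Qed.

Let half_W a : a.1 \in K -> half a \in parab W.
Proof. by move=> /HP[_ HW _]; rewrite /half; case: a.2; rewrite ?parabV ?parab_rev. Qed.

Let f_letter a : a.1 \in K -> f (letter a) = half a * letter (mid a) * reversal (half a).
Proof.
move=> aK; have [E _ _] := HP aK; case: a aK E => k [] kK /= E.
  rewrite letter_genV autV E !invgM /half /mid /= addbT reversalV reversalK.
  by rewrite -letterV !mulgA.
by rewrite letter_gen E /mid /half /= addbF.
Qed.

Let len_f_letter a : a.1 \in K -> len (f (letter a)) = (len (half a)).*2.+1.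
Proof.
move=> aK; have [_ _ El] := HP aK; rewrite len_half -El aut_letter.
by case: a.2; rewrite ?(tlenV KL).
Qed.

Let fB g : g \in B -> f g = g.
Proof.
move=> gB; apply: (aut_fix fU); apply: parabS gB; apply/subsetP => w.
by rewrite inE => /andP[wK /(subsetP WUK)]; rewrite inE (negPf wK) orbF.
Qed.

Let len_half_mid a : a.1 \in K -> len (half a * letter (mid a)) = (len (half a)).+1.
Proof.
move=> aK; have := len_f_letter aK; rewrite (f_letter aK).
have := tlenM KL (half a * letter (mid a)) (reversal (half a)).
have := tlenM KL (half a) (letter (mid a)); rewrite (tlen_rev KL) (tlen_letter KL) /= aK.
by move: (len (half a)) (len (half a * _)) (len (_ * reversal _)); clear; lia.
Qed.

Let len_mid_half a : a.1 \in K -> len (letter (mid a) * reversal (half a)) = (len (half a)).+1.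
Proof.
by move=> aK; rewrite -reversal_letter -reversalM (tlen_rev KL) len_half_mid.
Qed.

(** No half starts, up to the subgroup that [f] fixes, with the half and the
    middle letter that belong to another vertex of [K] or to its inverse. *)
Definition stuck := forall a b g y, a.1 \in K -> b.1 \in K -> a.1 != b.1 ->
  g \in B -> half a = g * half b * letter (mid b) * y ->
  len (half a) <> (len (half b) + len y).+1.

Section Stuck.
Hypothesis f_stuck : stuck.

(** When the images of two letters meet, the first one does not lose its middle:
    otherwise the half of the second one would contain it. *)
Let no_cancel a b g : a.1 \in K -> b.1 \in K -> g \in B ->
  let y := reversal (half a) * g * half b in
  len (letter (mid a) * y) = (len y).+1.
Proof.
move=> aK bK gB y; have maK : (mid a).1 \in K by [].
set z := letter (mid a) * y.
have z1 : len z <= (len y).+1.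
  by have := tlenM KL (letter (mid a)) y; rewrite (tlen_letter KL) maK.
have y1 : len y <= (len z).+1.
  have := tlenM KL (letter (mid a))^-1 z; rewrite mulKg (tlenV KL) (tlen_letter KL) maK.
  by [].
have odd_z : odd (len z) = ~~ odd (len y).
  by rewrite !(odd_tlen KL) parM par_letter maK addTb.
apply/eqP; rewrite eqn_leq z1 /= ltnNge; apply/negP => zy.
have {z1 zy y1} yz : len y = (len z).+1.
  apply/eqP; rewrite eqn_leq y1 ltn_neqAle zy andbT; apply/eqP => E.
  by move: odd_z; rewrite E; case: (odd _).
pose x := g^-1 * half (letter_inv a).
have x_len : len x = len (half a).
  by rewrite /x (tlenMl KL) ?half_inv ?(tlenV KL) ?(tlen_rev KL) // B_len.
have Eb : half b = x * letter (mid (letter_inv a)) * z.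
  by rewrite /x /z /y half_inv mid_inv letterV !gnorm.
have l1 : len (letter (mid (letter_inv a))) = 1%N by rewrite (tlen_letter KL) /= aK.
have lb : len (half b) = (len (half a) + len z).+1.
  rewrite Eb (tlen_local KL) ?l1 ?x_len ?addn1 ?addSn //.
    rewrite /x -mulgA (tlenMl KL) ?len_half_mid //; last by rewrite (tlenV KL) B_len.
    by rewrite half_inv (tlenV KL) (tlen_rev KL).
  by rewrite mid_inv letterV mulKg yz.
have [ab|ab] := eqVneq b.1 a.1.
  by move: lb; rewrite !len_half ab -addnS; move: (len _) (len z); clear; lia.
apply: (@f_stuck b (letter_inv a) g^-1 z bK aK ab _ Eb); first by rewrite parabV.
by rewrite lb !len_half.
Qed.

Let middle_survives a b g : a.1 \in K -> b.1 \in K -> g \in B ->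
  g \notin parab L \/ b <> letter_inv a ->
  let y := reversal (half a) * g * half b in
  len (letter (mid a) * y * letter (mid b)) = (len y).+2.
Proof.
move=> aK bK gB gab y.
have ay : len (letter (mid a) * y) = (len y).+1 by apply: no_cancel.
have yb : len (y * letter (mid b)) = (len y).+1.
  have := @no_cancel b a (reversal g) bK aK; rewrite parab_rev => /(_ gB) /=.
  rewrite -(tlen_rev KL (letter (mid b) * _)) -(tlen_rev KL (reversal (half b) * _ * _)).
  by rewrite !reversalM !reversalK reversal_letter !mulgA.
have [y0|y0] := posnP (len y); last first.
  by rewrite (tlen_local KL) ?ay ?yb ?(tlen_letter KL) /= ?aK ?bK ?addn1.
have yW : y \in parab W by rewrite !parabM ?parab_rev ?half_W ?B_W.
have yK := tlen0_parab KL y0.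
have [->|[ba yL]] := tlen2 KL (a := mid a) (b := mid b) aK bK yK; first by rewrite y0.
have Eab : b = letter_inv a.
  case: ba => ba; rewrite ba -addbN => /addbI br; rewrite /letter_inv -ba -br.
  exact: surjective_pairing.
(* [y] is a conjugate of [g] by a half, with which [y] commutes: so [y = g]. *)
case: gab => // /negP[]; suff <- : y = g by [].
rewrite /y Eab half_inv.
have rW : reversal (half a) \in parab W by rewrite parab_rev half_W.
have := LW_commute yL yW rW; rewrite /commute /y Eab half_inv !mulgA mulgVK -!mulgA.
by move=> /mulgI.
Qed.

(** When the images of the letters of a reduced word are multiplied, no factor
    reaches the middle letter of the factor before it. So the middle letters all
    survive, and so does the second half of the last factor. *)
Lemma survive x b : x \in parab W -> b.1 \in K -> len (x * letter b) = (len x).+1 ->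
  exists z, [/\ f (x * letter b) = z * letter (mid b) * reversal (half b),
    len (f (x * letter b)) = (len z + len (half b)).+1 & len x <= len z].
Proof.
have [n] := ubnP (len x); elim: n x b => // n IHn x b; rewrite ltnS => xn xW bK xb.
have [x0|x0] := posnP (len x).
  have xB := len_B xW x0; exists (x * half b); split; last by rewrite x0.
    by rewrite autM (fB xB) (f_letter bK) !mulgA.
  by rewrite autM (fB xB) !(tlenMl KL _ x0) len_f_letter // addnn.
have [|x' [b' [g [Ex b'K x'W gW [x'n xl]]]]] := @tlen_split_parab _ _ _ _ KL W x (len x).-1 KW xW.
  by rewrite prednK.
have g0 : len g = 0 by move: xl; rewrite x'n; move: (len x) (len g) x0; clear; lia.
have gB := len_B gW g0.
have x'b' : len (x' * letter b') = (len x').+1 by rewrite -(tlenMr KL _ g0) -Ex xl g0 addn0.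
have [|z [Ez lz x'z]] := IHn x' b' _ x'W b'K x'b'.
  by rewrite x'n; move: (len x) x0 xn; clear; lia.
set y := reversal (half b') * g * half b.
have cyc : len (letter (mid b') * y * letter (mid b)) = (len y).+2.
  apply: middle_survives => //.
  have [gL|] := boolP (g \in parab L); last by left.
  (* Otherwise [b] would cancel against [b'] already in [x b]. *)
  right=> bE; move: xb; rewrite Ex -mulgA -(link_commute KL bK gL) bE letterV !mulgA mulgK.
  rewrite !(tlenMr KL _ g0) x'b'.
  by move: (len x'); clear; lia.
have cy : len (letter (mid b') * y) = (len y).+1 by apply: no_cancel.
have yc : len (y * letter (mid b)) = (len y).+1.
  have := tlenM KL (letter (mid b')) (y * letter (mid b)); rewrite mulgA cyc (tlen_letter KL) /= b'K.
  have := tlenM KL y (letter (mid b)); rewrite (tlen_letter KL) /= bK.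
  by move: (len y) (len (y * _)); clear; lia.
have m'1 : len (letter (mid b')) = 1%N by rewrite (tlen_letter KL) /= b'K.
have m1 : len (letter (mid b)) = 1%N by rewrite (tlen_letter KL) /= bK.
have zm : len (z * letter (mid b')) = (len z).+1.
  have := tlenM KL (z * letter (mid b')) (reversal (half b')); rewrite -Ez lz (tlen_rev KL).
  have := tlenM KL z (letter (mid b')); rewrite m'1.
  by move: (len z) (len (z * _)) (len (half b')); clear; lia.
have zmy : len (z * letter (mid b') * y) = (len z + len y).+1.
  by rewrite (tlen_local KL) ?m'1 ?zm ?cy ?addn1 ?addSn // add1n.
have zmyc : len (z * letter (mid b') * y * letter (mid b)) = (len z + len y).+2.
  rewrite -mulgA (tlen_local KL) ?m'1 ?zm ?yc ?addn1 ?addSn ?addnS //.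
  by rewrite mulgA cyc.
exists (z * letter (mid b') * y); split.
- rewrite Ex !autM -(autM f x') Ez (fB gB) (f_letter bK) /y !mulgA //.
- have -> : f (x * letter b) = z * letter (mid b') * y * letter (mid b) * reversal (half b).
    by rewrite Ex !autM -(autM f x') Ez (fB gB) (f_letter bK) /y !mulgA.
  rewrite (tlen_local KL) ?m1 ?zmyc ?zmy ?len_mid_half ?(tlen_rev KL) ?addn1 ?addSn //.
- by rewrite zmy xl g0 addn0 ltnS (leq_trans x'z) // leq_addr.
Qed.

(** A vertex of [K] has length 1, so its preimage contains only one letter of [K]
    and the half of the image of this letter has length 0. *)
Lemma stuck_half k : k \in K -> len (H k) = 0.
Proof.
move=> kK; set x := f^-1 (gen k).
have fx : f x = gen k by rewrite /x -autME mulgV.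
have xW : x \in parab W by rewrite -(up_K kK); apply/pure_support/pureV.
have lk1 : len (gen k) = 1%N by rewrite -letter_gen (tlen_letter KL) /= kK.
have [x0|x0] := posnP (len x).
  by move: lk1; rewrite -fx (fB (len_B xW x0)) x0.
have [|x' [b [g [Ex bK x'W gW [x'n xl]]]]] := @tlen_split_parab _ _ _ _ KL W x (len x).-1 KW xW.
  by rewrite prednK.
have g0 : len g = 0 by move: xl; rewrite x'n; move: (len x) (len g) x0; clear; lia.
have gB := len_B gW g0.
have x'b : len (x' * letter b) = (len x').+1 by rewrite -(tlenMr KL _ g0) -Ex xl g0 addn0.
have [z [Ez lz x'z]] := survive x'W bK x'b.
have : len (f (x' * letter b)) = 1%N.
  by rewrite -(tlenMr KL _ g0) -[X in _ * X](fB gB) -autM -Ex fx.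
rewrite lz => -[/eqP]; rewrite addn_eq0 => /andP[/eqP z0 /eqP h0].
have x'B : x' \in B by apply: len_B x'W _; move: x'z; rewrite z0 leqn0 => /eqP.
have bk : b.1 = k.
  have := fP.2 [set b.1] x; rewrite fx par_gen inE Ex !parM par_letter inE eqxx.
  rewrite !(@par_parab _ _ _ (W :\: K)) ?addbF //=; try by rewrite disjoints1 inE bK.
  by move/eqP->.
by rewrite -bk -len_half.
Qed.

End Stuck.

(** If [half a = g half(b) mid(b) y], replacing [a] by [h a h^rev] with
    [h = b^-1 g^-1] replaces [half a] by [half(b)^-rev y], which is shorter. *)
Lemma unstuck : ~ stuck -> exists i d, [/\ i \in K, generated d, pure d,
  forall k, k != i -> d (gen k) = gen k & len ((f * d) (gen i)) < len (f (gen i))].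
Proof.
move=> nst; have [a [b [g [y [aK bK ab gB [Ea la]]]]]] : exists a b g y,
    [/\ a.1 \in K, b.1 \in K, a.1 != b.1, g \in B &
        half a = g * half b * letter (mid b) * y /\ len (half a) = (len (half b) + len y).+1].
  apply: contra_notP nst => no a b g y aK bK ab gB Ea la; apply: no.
  by exists a, b, g, y.
pose h := letter (letter_inv b) * g^-1.
have hP : h \in parab (up a.1 :\ a.1).
  by apply: parabM; [apply: K_up | apply: B_up; rewrite ?parabV].
pose h' := if a.2 then (reversal h)^-1 else h.
have h'P : h' \in parab (up a.1 :\ a.1) by rewrite /h'; case: a.2; rewrite ?parabV ?parab_rev.
have [d [di dk dG dP]] := sandwich_pure e_sym h'P.
exists a.1, d; split=> //.
have da : d (letter a) = h * letter a * reversal h.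
  rewrite aut_letter di /h'; case: a {aK ab Ea la hP h'P di dk h'} => k [] //=.
  by rewrite letter_genV reversalV reversalK !gnorm.
have fh : f h * half a = (reversal (half b))^-1 * y.
  rewrite /h autM autV (fB gB) (f_letter (a := letter_inv b)) // half_inv mid_inv letterV Ea.
  by rewrite reversalV reversalK !gnorm.
clearbody h.
have fda : (f * d) (letter a) = f h * half a * letter (mid a) * reversal (f h * half a).
  rewrite autME da (autM f (h * letter a)) (autM f h) (f_letter aK) reversalM.
  by rewrite -(centraliser_rev fP.1) !mulgA.
have lenE d' : len (d' (gen a.1)) = len (d' (letter a)).
  by rewrite aut_letter; case: a.2; rewrite ?(tlenV KL).
rewrite !lenE (len_f_letter aK) fda fh la.
set z := _ * y.
have lz : len z <= len (half b) + len y.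
  by rewrite (leq_trans (tlenM KL _ _)) // (tlenV KL) (tlen_rev KL).
have := tlenM KL (z * letter (mid a)) (reversal z); have := tlenM KL z (letter (mid a)).
rewrite (tlen_rev KL) (tlen_letter KL) /= aK.
move: (len _) (len (z * _)) (len z) (len (half b)) (len y) lz; clear; lia.
Qed.

End Halves.

(** Once the halves avoid [K] the images are cleared one after the other. *)
Lemma free_class_finish : (forall d, pure d -> fixes d (U :|: K) -> generated d) ->
  forall f, pure f -> fixes f U ->
  (forall k, k \in K -> exists h c, h \in B /\ f (gen k) = h * letter (k, c) * reversal h) ->
  generated f.
Proof.
move=> IH f; have [n] := ubnP #|[set k in K | f (gen k) != gen k]|.
elim: n f => // n IHn f; rewrite ltnS => fn fP fU fK.
have [K0|[k]] := set_0Vmem [set k in K | f (gen k) != gen k].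
  apply: IH => // w /setUP[/fU//|wK]; apply/eqP; have := in_set0 w.
  by rewrite -K0 inE wK => /negbFE.
rewrite inE => /andP[kK fk]; have [h [c [hB Ek]]] := fK k kK.
have h'P : h^-1 \in parab (up k :\ k) by rewrite B_up ?parabV.
have [d [dk dw dG dP]] := sandwich_pure e_sym h'P.
have fh : f h = h.
  apply: (aut_fix fU); apply: parabS hB; apply/subsetP => w.
  by rewrite inE => /andP[wK /(subsetP WUK)]; rewrite inE (negPf wK) orbF.
have fdk : (f * d) (gen k) = letter (k, c).
  rewrite autME dk !autM reversalV !autV (centraliser_rev fP.1) fh Ek.
  by rewrite !gnorm.
have [d' [d'G d'P d'w fd'k]] : exists d', [/\ generated d', pure d',
    forall w, w != k -> d' (gen w) = gen w & (f * d) (d' (gen k)) = gen k].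
  case: c fdk {Ek} => fdk; last first.
    exists 1; split=> //; first exact: subgroup_gen1.
    by split=> //; apply: commute1.
  have [d' [[d'k d'w] d'G d'P]] := inversion_pure e k.
  by exists d'; split=> //; rewrite d'k autV fdk letter_genV invgK.
apply: (generatedMr dG); apply: (generatedMr d'G).
have Ew w : w != k -> (f * d * d') (gen w) = f (gen w).
  by move=> wk; rewrite !autME d'w // dw.
have Ekk : (f * d * d') (gen k) = gen k by rewrite autME fd'k.
apply: IHn => //.
- apply: leq_trans fn; apply: proper_card; apply/properP; split.
    apply/subsetP => w; rewrite !inE => /andP[->]; have [->|wk] := eqVneq w k.
      by rewrite Ekk eqxx.
    by rewrite Ew.
  by exists k; rewrite !inE kK // Ekk eqxx.
- by do 2!apply: pureM => //.
- move=> u uU; rewrite Ew ?fU //; apply: contraTneq uU => ->.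
  by rewrite (disjointFr KU kK).
move=> w wK; have [->|wk] := eqVneq w k; last by rewrite Ew //; apply: fK.
by exists 1, false; rewrite parab1 Ekk reversal1 mul1g mulg1.
Qed.

(** Each reduction lowers the total length of the images of [K]. *)
Lemma free_class : (forall d, pure d -> fixes d (U :|: K) -> generated d) ->
  forall f, pure f -> fixes f U -> generated f.
Proof.
move=> IH f; pose N f := \sum_(k in K) len (f (gen k)).
have [n] := ubnP (N f); elim: n f => // n IHn f; rewrite ltnS => fn fP fU.
have [H [c HP]] : exists (H : V -> A) (c : V -> bool), forall k, k \in K ->
    [/\ f (gen k) = H k * letter (k, c k) * reversal (H k), H k \in parab W &
      len (f (gen k)) = (len (H k)).*2.+1].
  pose P k (hc : A * bool) := k \in K ->
    [/\ f (gen k) = hc.1 * letter (k, hc.2) * reversal hc.1, hc.1 \in parab W &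
      len (f (gen k)) = (len hc.1).*2.+1].
  have [|F FP] := @choice _ _ P.
    move=> k; have [kK|kK] := boolP (k \in K); last by exists (1, false); rewrite /P (negPf kK).
    by have [h [b hb]] := half_exists fP kK; exists (h, b).
  by exists (fun k => (F k).1), (fun k => (F k).2).
have [st|nst] := pselect (stuck H c).
  apply: free_class_finish => // k kK; have [Ek HW _] := HP k kK.
  exists (H k), (c k); split=> //; apply: len_B HW _.
  exact: (stuck_half fP fU HP st kK).
have [i [d [iK dG dP dk lti]]] := unstuck fP fU HP nst.
apply: (generatedMr dG); apply: IHn; last 2 first.
- exact: pureM.
- move=> u uU; rewrite autME dk ?fU //; apply: contraTneq uU => ->.
  by rewrite (disjointFr KU iK).
apply: leq_trans fn; rewrite /N (bigD1 i) //= [leqRHS](bigD1 i) //= -addSn leq_add //.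
by apply: leq_sum => k /andP[_ ki]; rewrite dk.
Qed.

End FreeClass.

(** * Elimination over the dominance order *)

Section Elimination.
Variables (V : finType) (e : rel V).
Hypotheses (e_sym : symmetric e) (e_irr : irreflexive e).
Local Notation gen := (gen e).
Local Notation generated := (@generated V e).
Local Notation pure := (@pure V e).
Local Notation up := (up e).
Implicit Types (u v w k : V) (f : aut (raag e)) (U : {set V}).

(** The classes of mutually dominating vertices are cleared from the top. Such a
    class either spans a clique together with everything above it, or is
    independent and then has a common link. *)
Lemma pure_gen f : pure f -> generated f.
Proof.
suff main n U : #|~: U| <= n -> (forall u, u \in U -> up u \subset U) ->
    forall f, pure f -> fixes f U -> generated f.
  by move=> fP; apply: (main _ finset.set0 (leqnn _) _ f fP) => u; rewrite inE.
elim: n U => [|n IHn] U Un Uup {}f fP fU.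
  have -> : f = 1.
    apply: aut_gen_ext => v; rewrite aut1E; apply: fU.
    by move: Un; rewrite leqn0 cards_eq0 => /eqP/setP/(_ v); rewrite !inE => /negbFE.
  exact: subgroup_gen1.
have [U0|[v0 v0U]] := set_0Vmem (~: U).
  by apply: (IHn U) => //; rewrite U0 cards0.
(* With the fewest vertices above it, [v] is maximal outside [U]. *)
have [v vU vmin] : exists2 v, v \notin U & forall u, u \notin U -> #|up v| <= #|up u|.
  rewrite inE in v0U; have [v vU vmin] := arg_minnP (P := [predC U]) (fun v => #|up v|) v0U.
  by exists v.
pose K := [set u in up v | dominated e u v].
have vK : v \in K by rewrite !inE !dominated_refl.
have upK : {in K, forall k, up k = up v}.
  move=> k; rewrite !inE => /andP[vk kv]; apply/eqP.
  by rewrite eqEsubset !up_sub.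
have KU : [disjoint K & U].
  apply/pred0P => k /=; apply/negbTE/negP => /andP[kK kU].
  case/negP: vU; apply: (subsetP (Uup k kU)).
  by move: kK; rewrite !inE => /andP[_].
have WUK : up v \subset U :|: K.
  apply/subsetP => u uv; rewrite inE; have [//|uU] := boolP (u \in U).
  rewrite inE uv /=; have uv' := uv; rewrite inE in uv'.
  have : up u == up v.
    by rewrite eqEcard (up_sub e_sym uv') vmin.
  by move=> /eqP/setP/(_ v); rewrite !inE dominated_refl.
have KW : K \subset up v by apply/subsetP => k; rewrite inE => /andP[].
have IH d : pure d -> fixes d (U :|: K) -> generated d.
  apply: IHn; last first.
    move=> u /setUP[uU|uK]; last by rewrite upK.
    by apply: subset_trans (Uup u uU) (subsetUl _ _).
  rewrite -ltnS; apply: leq_trans Un; apply: proper_card; apply/properP; split.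
    by rewrite setCS subsetUl.
  by exists v; rewrite in_setC // in_setU vK orbT.
have K_dom k k' : k \in K -> k' \in K -> dominated e k k'.
  by move=> kK k'K; have := up_refl e k'; rewrite (upK k' k'K) -(upK k kK) inE.
have KW_dom k u : k \in K -> u \in up v -> dominated e k u.
  by move=> kK; rewrite -(upK k kK) inE.
have domE k u w : dominated e k u -> e k w -> (w == u) || e u w.
  by move=> /subsetP/(_ w); rewrite !inE; apply.
have [[k kK [k' k'K kk']]|indep] := pselect (exists2 k, k \in K & exists2 k', k' \in K & e k k').
  apply: (clique_class e_sym e_irr KU WUK KW _ upK IH fP fU).
  have k_up u : u \in up v -> u != k -> e k u.
    move=> uv uk; have := domE k u k' (KW_dom k u kK uv) kk'.
    case/orP=> [/eqP <- //|uk'].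
    have := domE k' k u (K_dom k' k k'K kK); rewrite e_sym uk' (negPf uk).
    by apply.
  move=> u w uv wv uw; have [uk|uk] := eqVneq u k.
    by rewrite uk; apply: k_up => //; rewrite -uk eq_sym.
  have := domE k w u (KW_dom k w kK wv) (k_up u uv uk).
  by rewrite (negPf uw) e_sym.
pose L := lk e v.
have KL : common_link e K L.
  have K_indep : {in K &, forall k k', ~~ e k k'}.
    by move=> k k' kK k'K; apply/negP => kk'; apply: indep; exists k => //; exists k'.
  split=> // k kK; have sub k1 k2 : k1 \in K -> k2 \in K -> lk e k1 \subset lk e k2.
    move=> k1K k2K; apply/subsetP => w; rewrite !inE => k1w.
    have /orP[/eqP wk2|//] := domE k1 k2 w (K_dom k1 k2 k1K k2K) k1w.
    by move: (K_indep k1 k2 k1K k2K); rewrite -wk2 k1w.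
  by apply/eqP; rewrite eqEsubset !sub.
apply: (free_class e_sym e_irr KL KU WUK KW upK _ IH fP fU).
move=> u w; rewrite !in_setI => /andP[uL uv] wv uw.
have := domE v w u (KW_dom v w vK wv); rewrite inE in uL.
by rewrite uL (negPf uw) e_sym; apply.
Qed.

End Elimination.

Local Open Scope classical_set_scope.

Theorem corollary3p8 (V : finType) (e : rel V)
  (e_sym : symmetric e) (e_irr : irreflexive e) :
  centraliser (raag_iota e) =
  subgroup_gen (diagram_auts e `|` adjacent_dominated_transvections e
                `|` inversions e `|` dominated_elem_palindromics e).
Proof.
apply/seteqP; split; last exact: generated_centraliser.
apply: (pure_reduction e_sym e_irr) => f.
exact: (pure_gen e_sym e_irr).
Qed.
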